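(* Let $k$ be a perfect field of prime characteristic, and let $(A,\mathfrak{m})$ be a regular local ring that is essentially of finite type over $k$ with fraction field $K$. Let $\nu$ and $w$ be nontrivial, real-valued Abhyankar valuations of $K/k$, both centered on $(A,\mathfrak{m})$. Then there exists a real number $C>0$ such that for all $x\in A-\{0\}$, $$\nu(x)\le C\,w(x).$$
   Context: A ring is essentially of finite type over $k$ if it is a localization of a finitely generated $k$-algebra at some multiplicative set. A valuation $\nu$ of a finitely generated field extension $K/k$ with value group $\Gamma_\nu$ (a totally ordered abelian group, written additively) is a surjective group homomorphism $\nu: K^\times \to \Gamma_\nu$ with $\nu(k^\times)=\{0\}$ and $\nu(x+y)\ge \min\{\nu(x),\nu(y)\}$ whenever $x,y,x+y \neq 0$. Its valuation ring is $R_\nu=\{x\in K^\times:\nu(x)\ge 0\}\cup\{0\}$, a local ring with maximal ideal $\mathfrak{m}_\nu$ and residue field $\kappa_\nu$. It is real-valued if $\Gamma_\nu$ is an ordered subgroup of $\mathbb{R}$. It is an Abhyankar valuation if $\dim_{\mathbb{Q}}(\mathbb{Q}\otimes_{\mathbb{Z}}\Gamma_\nu) + \operatorname{tr.deg}(\kappa_\nu/k) = \operatorname{tr.deg}(K/k)$. It is centered on $(A,\mathfrak{m})$ if $A\subseteq R_\nu$ and $\mathfrak{m}=\mathfrak{m}_\nu\cap A$. *)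

(* Defs.v *)
From HB Require Import structures.
From mathcomp Require Import all_boot all_order all_algebra.
From mathcomp Require Import boolp classical_sets reals.
From mathcomp Require Import mpoly.

Set Implicit Arguments.
Unset Strict Implicit.
Unset Printing Implicit Defensive.

Import Order.TTheory GRing.Theory Num.Theory.
Local Open Scope classical_set_scope.
Local Open Scope ring_scope.

(* k-algebras and field extensions of k are given by their structure           *)
(* morphisms, as {rmorphism k -> B}.                                          *)

Definition perfect_char (p : nat) (k : fieldType) : Prop :=
  exists charkp : p \in [pchar k],
    forall c : k, exists b : k, pFrobenius_aut charkp b = c.

Section Ideals.
Variable A : comNzRingType.
Implicit Types (I M P : set A).

Definition is_ideal I : Prop :=
  [/\ I 0, forall x y, I x -> I y -> I (x + y) & forall a x, I x -> I (a * x)].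

Definition is_prime P : Prop :=
  [/\ is_ideal P, ~ P 1 & forall x y, P (x * y) -> P x \/ P y].

Definition is_maximal M : Prop :=
  [/\ is_ideal M, ~ M 1 &
      forall I, is_ideal I -> M `<=` I -> I = M \/ I = setT].

Definition ideal_gen n (g : 'I_n -> A) : set A :=
  [set x | exists a : 'I_n -> A, x = \sum_(i < n) a i * g i].

Definition noetherian : Prop :=
  forall I, is_ideal I -> exists n (g : 'I_n -> A), I = ideal_gen g.

Definition is_local M : Prop :=
  is_maximal M /\ forall M', is_maximal M' -> M' = M.

(* A chain of length n has n + 1 primes P 0 < ... < P n; the values of P       *)
(* beyond n are irrelevant.                                                   *)
Definition has_prime_chain (n : nat) : Prop :=
  exists P : nat -> set A,
    (forall i, (i <= n)%N -> is_prime (P i)) /\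
    (forall i, (i < n)%N -> P i `<` P i.+1).

Definition krull_dim (d : nat) : Prop :=
  has_prime_chain d /\ forall n, has_prime_chain n -> (n <= d)%N.

Definition regular_local M : Prop :=
  [/\ noetherian, is_local M &
      exists d (g : 'I_d -> A), krull_dim d /\ M = ideal_gen g].

End Ideals.

Definition multiplicative_set (B : comNzRingType) (S : set B) : Prop :=
  S 1 /\ forall s t, S s -> S t -> S (s * t).

(* phi exhibits A as S^-1 B: the elements of S become units, every element of  *)
(* A is a fraction phi b / phi s, and phi kills exactly the S-torsion.         *)
Definition is_localization (B A : comNzRingType) (S : set B)
    (phi : {rmorphism B -> A}) : Prop :=
  [/\ forall s, S s -> exists u, phi s * u = 1,
      forall a, exists b s, S s /\ a * phi s = phi b &
      forall b, phi b = 0 -> exists s, S s /\ s * b = 0].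

Definition finitely_generated_alg (k : fieldType) (B : comNzRingType)
    (j : {rmorphism k -> B}) : Prop :=
  exists n (x : 'I_n -> B), forall b, exists p : {mpoly k[n]}, b = mmap j x p.

Definition ess_finite_type (k : fieldType) (A : comNzRingType)
    (j : {rmorphism k -> A}) : Prop :=
  exists (B : comNzRingType) (jB : {rmorphism k -> B}) (S : set B)
         (phi : {rmorphism B -> A}),
    [/\ finitely_generated_alg jB, multiplicative_set S,
        is_localization S phi & forall c, phi (jB c) = j c].

Definition is_fraction_field (A : comNzRingType) (K : fieldType)
    (iota : {rmorphism A -> K}) : Prop :=
  injective iota /\
  forall z : K, exists a b : A, b != 0 /\ z = iota a / iota b.

Section TranscendenceDegree.
Variables (k L : fieldType) (f : {rmorphism k -> L}).

Definition alg_independent n (x : 'I_n -> L) : Prop :=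
  forall p : {mpoly k[n]}, mmap f x p = 0 -> p = 0.

(* the subfield k(x_1, ..., x_n) of L *)
Definition adjoin n (x : 'I_n -> L) : set L :=
  [set z | exists p q : {mpoly k[n]},
             mmap f x q != 0 /\ z = mmap f x p / mmap f x q].

Definition algebraic_over_set (E : set L) (y : L) : Prop :=
  exists p : {poly L}, [/\ p != 0, forall i, E p`_i & root p y].

(* L/k has a finite transcendence basis with n elements. *)
Definition trdeg (n : nat) : Prop :=
  exists x : 'I_n -> L,
    alg_independent x /\ forall y, algebraic_over_set (adjoin x) y.

End TranscendenceDegree.

Section RationalRank.
Variable R : realType.
Implicit Types (G V : set R).

(* Q (x)_Z G for a subgroup G of R, realized as the Q-subspace QG of R via     *)
(* q (x) g |-> q g; tensorQ_universal below is its universal property.         *)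
Definition tensorQ G : set R :=
  [set z | exists q : rat, exists2 g, G g & z = ratr q * g].

Definition dimQ V (n : nat) : Prop :=
  exists e : 'I_n -> R,
    [/\ forall i, V (e i),
        forall c : 'I_n -> rat,
          \sum_(i < n) ratr (c i) * e i = 0 -> forall i, c i = 0 &
        forall z, V z -> exists c : 'I_n -> rat,
          z = \sum_(i < n) ratr (c i) * e i].

Lemma tensorQ_universal G (W : lmodType rat) (h : R -> W) :
    G 0 -> (forall x y, G x -> G y -> G (x - y)) ->
    (forall x y, G x -> G y -> h (x - y) = h x - h y) ->
  exists g : R -> W,
    [/\ forall q x, G x -> g (ratr q * x) = q *: h x,
        forall y z, tensorQ G y -> tensorQ G z -> g (y + z) = g y + g z &
        forall q z, tensorQ G z -> g (ratr q * z) = q *: g z].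
Proof.
move=> G0 GB hB.
have h0 : h 0 = 0 by rewrite -(subr0 0) hB // subrr.
have GN x : G x -> G (- x) by move=> Gx; rewrite -sub0r; apply: GB.
have hN x : G x -> h (- x) = - h x by move=> Gx; rewrite -sub0r hB // h0 sub0r.
have GD x y : G x -> G y -> G (x + y).
  by move=> Gx Gy; rewrite -(opprK y); apply: GB => //; apply: GN.
have hD x y : G x -> G y -> h (x + y) = h x + h y.
  by move=> Gx Gy; rewrite -{1}(opprK y) hB ?hN ?opprK //; apply: GN.
have Gn n x : G x -> G (x *+ n) /\ h (x *+ n) = h x *+ n.
  move=> Gx; elim: n => [|n [Gxn hxn]]; first by rewrite !mulr0n.
  by rewrite !mulrS hD ?hxn //; split=> //; apply: GD.
have Gz (m : int) x : G x -> G (m%:~R * x) /\ h (m%:~R * x) = m%:~R *: h x.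
  move=> Gx; case: m => n.
    rewrite -!pmulrn mulr_natl scaler_nat; exact: Gn.
  have [Gxn hxn] := Gn n.+1 x Gx.
  rewrite NegzE !mulrNz -!pmulrn mulNr scaleNr mulr_natl scaler_nat.
  by rewrite hN // hxn; split=> //; apply: GN.
have ratrE (q : rat) : ratr q = (numq q)%:~R / (denq q)%:~R :> R by [].
have nzd (q : rat) : (denq q)%:~R != 0 :> R by rewrite intr_eq0 denq_eq0.
have nzdQ (q : rat) : (denq q)%:~R != 0 :> rat by rewrite intr_eq0 denq_eq0.
have clear2 (q r : rat) x : ratr q * x * (denq q * denq r)%:~R =
    (numq q * denq r)%:~R * x :> R.
  by rewrite ratrE !intrM; rewrite mulrACA -!mulrA; congr (_ * _);
     rewrite [x * _]mulrC !mulrA mulVf // mul1r mulrC.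
have clear2h (q r : rat) (u : W) :
    (denq q * denq r)%:~R *: (q *: u) = (numq q * denq r)%:~R *: u.
  rewrite scalerA -{2}(divq_num_den q) !intrM; congr (_ *: _).
  by rewrite mulrAC mulrCA mulfV // mulr1.
have wd q r x y : G x -> G y -> ratr q * x = ratr r * y -> q *: h x = r *: h y.
  move=> Gx Gy E; have nz : (denq q * denq r)%:~R != 0 :> rat.
    by rewrite intrM mulf_neq0.
  apply: (scalerI nz); rewrite clear2h [denq q * _]mulrC clear2h.
  have [_ <-] := Gz (numq q * denq r) x Gx; have [_ <-] := Gz (numq r * denq q) y Gy.
  by rewrite -clear2 E [denq q * _]mulrC clear2.
have [g gE] : exists g : R -> W, forall z, tensorQ G z ->
    exists q, exists2 x, G x & z = ratr q * x /\ g z = q *: h x.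
  suff /choice[g gE] : forall z, exists w, tensorQ G z ->
      exists q, exists2 x, G x & z = ratr q * x /\ w = q *: h x by exists g.
  move=> z; case: (pselect (tensorQ G z)) => [[q [x Gx ->]]|nz]; last by exists 0.
  by exists (q *: h x) => _; exists q; exists x.
have gr q x : G x -> g (ratr q * x) = q *: h x.
  move=> Gx; have [|r [y Gy [E ->]]] := gE (ratr q * x); first by exists q; exists x.
  by apply: wd.
exists g; split => //.
  move=> _ _ [q [x Gx ->]] [r [y Gy ->]]; rewrite !gr //.
  set d : int := denq q * denq r.
  have nz : d%:~R != 0 :> R by rewrite intrM mulf_neq0.
  have nzQ : d%:~R != 0 :> rat by rewrite intrM mulf_neq0.
  have [Gx' hx'] := Gz (numq q * denq r) x Gx.
  have [Gy' hy'] := Gz (numq r * denq q) y Gy.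
  set t := (numq q * denq r)%:~R * x + (numq r * denq q)%:~R * y.
  have -> : ratr q * x + ratr r * y = ratr (d%:~R^-1) * t.
    have -> : ratr (d%:~R^-1) = d%:~R^-1 :> R by rewrite fmorphV /= ratr_int.
    apply: (mulfI nz); rewrite mulrA mulfV // mul1r mulrDr.
    by rewrite /d mulrC clear2 [d%:~R * _]mulrC /d [denq q * _]mulrC clear2.
  rewrite gr; last exact: GD.
  apply: (scalerI nzQ); rewrite scalerA mulfV // scale1r hD // hx' hy' scalerDr.
  by rewrite /d clear2h [denq q * _]mulrC clear2h.
by move=> q _ [r [x Gx ->]]; rewrite mulrA -rmorphM !gr // scalerA.
Qed.

End RationalRank.

(* A real-valued valuation of K/k; the value at 0 is a junk value.  The value  *)
(* group is the image of K \ {0}, with the order induced by R.                 *)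
Record valuation (k K : fieldType) (f : {rmorphism k -> K}) (R : realType) :=
  Valuation {
    val_fun :> K -> R;
    val_mul : forall x y, x != 0 -> y != 0 ->
      val_fun (x * y) = val_fun x + val_fun y;
    val_base : forall c, c != 0 -> val_fun (f c) = 0;
    val_add : forall x y, x != 0 -> y != 0 -> x + y != 0 ->
      Num.min (val_fun x) (val_fun y) <= val_fun (x + y)
  }.

Section ValuationTheory.
Variables (k K : fieldType) (f : {rmorphism k -> K}) (R : realType).
Variable v : valuation f R.

Definition value_group : set R := v @` [set x | x != 0].

Definition nontrivial : Prop := exists2 x, x != 0 & v x != 0.

Definition val_ge0 : {pred K} := fun x => (x == 0) || (0 <= v x).
Definition val_gt0 : {pred K} := fun x => (x == 0) || (0 < v x).

Lemma val1 : v 1 = 0.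
Proof. by rewrite -(rmorph1 f) val_base ?oner_eq0. Qed.

Lemma valN1 : v (-1) = 0.
Proof. by rewrite -(rmorphN1 f) val_base ?oppr_eq0 ?oner_eq0. Qed.

Lemma valN x : v (- x) = v x.
Proof.
have [->|x0] := eqVneq x 0; first by rewrite oppr0.
by rewrite -mulN1r val_mul ?oppr_eq0 ?oner_eq0 // valN1 add0r.
Qed.

Lemma valV x : x != 0 -> v x^-1 = - v x.
Proof.
move=> x0; apply/eqP; rewrite -addr_eq0 -val_mul ?invr_eq0 // mulVf //.
by rewrite val1.
Qed.

Lemma val_ge0_subring : subring_closed val_ge0.
Proof.
split; rewrite /val_ge0 /in_mem /=.
- by rewrite val1 lexx orbT.
- move=> x y; rewrite /in_mem /=.
  have [->|x0] /= := eqVneq x 0; first by rewrite sub0r oppr_eq0 valN.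
  have [->|y0] /= := eqVneq y 0; first by rewrite subr0 => ->; rewrite orbT.
  move=> vx vy; have [//|xy0] /= := eqVneq (x - y) 0.
  apply: le_trans (val_add v x0 _ xy0); last by rewrite oppr_eq0.
  by rewrite valN le_min vx.
- move=> x y; rewrite /in_mem /=.
  have [->|x0] /= := eqVneq x 0; first by rewrite mul0r eqxx.
  have [->|y0] /= := eqVneq y 0; first by rewrite mulr0 eqxx.
  by move=> vx vy; rewrite val_mul // addr_ge0 // orbT.
Qed.

HB.instance Definition _ := GRing.isSubringClosed.Build K val_ge0 val_ge0_subring.

Record valuation_ring := ValuationRing {
  vr_val : K;
  vr_valP : vr_val \in val_ge0
}.

HB.instance Definition _ := [isSub for vr_val].
HB.instance Definition _ := [Choice of valuation_ring by <:].
HB.instance Definition _ := [SubChoice_isSubComNzRing of valuation_ring by <:].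

Lemma vr_val0 : vr_val 0 = 0.
Proof. exact: (raddf0 (val : valuation_ring -> K)). Qed.
Lemma vr_val1 : vr_val 1 = 1.
Proof. exact: (rmorph1 (val : valuation_ring -> K)). Qed.
Lemma vr_valD x y : vr_val (x + y) = vr_val x + vr_val y.
Proof. exact: (raddfD (val : valuation_ring -> K)). Qed.
Lemma vr_valM x y : vr_val (x * y) = vr_val x * vr_val y.
Proof. exact: (rmorphM (val : valuation_ring -> K)). Qed.

Definition valuation_ideal : {pred valuation_ring} :=
  fun x => vr_val x \in val_gt0.

Lemma valuation_idealE x :
  (x \in valuation_ideal) = (vr_val x == 0) || (0 < v (vr_val x)).
Proof. by []. Qed.

Lemma valuation_idealP : idealr_closed valuation_ideal.
Proof.
split.
- by rewrite valuation_idealE vr_val0 eqxx.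
- by rewrite valuation_idealE vr_val1 oner_eq0 val1 ltxx.
- move=> a x y; rewrite !valuation_idealE vr_valD vr_valM.
  case: a x y => [a va] [x vx] [y vy] /=.
  move: va vx vy; rewrite /val_ge0 /in_mem /= => va vx vy hx hy.
  have: (a * x == 0) || (0 < v (a * x)).
    have [->|a0] := eqVneq a 0; first by rewrite mul0r eqxx.
    have [->|x0] := eqVneq x 0; first by rewrite mulr0 eqxx.
    move: va hx; rewrite (negbTE a0) (negbTE x0) /= => va hx.
    by rewrite val_mul // ltr_wpDl ?orbT.
  have [->|ax0] /= := eqVneq (a * x) 0; first by rewrite add0r.
  move=> hax; move: hy; have [->|y0] /= := eqVneq y 0.
    by rewrite addr0 hax orbT.
  move=> hy; have [//|s0] /= := eqVneq (a * x + y) 0.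
  by apply: lt_le_trans (val_add v ax0 y0 s0); rewrite lt_min hax.
Qed.

HB.instance Definition _ :=
  isIdealr.Build valuation_ring valuation_ideal valuation_idealP.

Definition residue_field := {ideal_quot valuation_ideal}.
HB.instance Definition _ := GRing.ComNzRing.on residue_field.
HB.instance Definition _ := EqQuotient.on residue_field.

Definition residue (x : valuation_ring) : residue_field :=
  (\pi_({ideal_quot valuation_ideal}) x)%qT.

Lemma residue_zmod_morphism : zmod_morphism residue.
Proof. exact: (raddfB (\pi_({ideal_quot valuation_ideal}))%qT). Qed.

Lemma residue_monoid_morphism : monoid_morphism residue.
Proof.
split; first exact: (rmorph1 (\pi_({ideal_quot valuation_ideal}))%qT).
exact: (rmorphM (\pi_({ideal_quot valuation_ideal}))%qT).
Qed.

HB.instance Definition _ :=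
  GRing.isZmodMorphism.Build valuation_ring residue_field residue
    residue_zmod_morphism.
HB.instance Definition _ :=
  GRing.isMonoidMorphism.Build valuation_ring residue_field residue
    residue_monoid_morphism.

Lemma residue_eq0 x : (residue x == 0) = (x \in valuation_ideal).
Proof.
rewrite -[in RHS](subr0 x) Quotient.idealrBE -(raddf0 residue).
by [].
Qed.

Lemma residue_repr (r : residue_field) :
  residue (repr (r : {ideal_quot valuation_ideal})) = r.
Proof. exact: reprK. Qed.

Lemma vr_val_inv_ge0 (x : valuation_ring) :
  x \notin valuation_ideal -> (vr_val x)^-1 \in val_ge0.
Proof.
rewrite valuation_idealE negb_or -leNgt => /andP[x0 vx].
by rewrite /val_ge0 /in_mem /= valV // oppr_ge0 vx orbT.
Qed.

Definition vr_inv (x : valuation_ring) : valuation_ring :=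
  insubd 0 (vr_val x)^-1.

Lemma vr_val_inv x :
  x \notin valuation_ideal -> vr_val (vr_inv x) = (vr_val x)^-1.
Proof. by move=> xI; apply: insubdK; apply: vr_val_inv_ge0. Qed.

Definition residue_inv (r : residue_field) : residue_field :=
  if r == 0 then 0
  else residue (vr_inv (repr (r : {ideal_quot valuation_ideal}))).

Lemma residue_mulVf (r : residue_field) : r != 0 -> residue_inv r * r = 1.
Proof.
move=> r0; rewrite /residue_inv (negbTE r0) -{2}(residue_repr r) -rmorphM.
move: r0; rewrite -{1}(residue_repr r) residue_eq0; set x := repr _ => xI.
have x0 : vr_val x != 0.
  by move: xI; rewrite valuation_idealE negb_or => /andP[].
rewrite -(rmorph1 residue); congr residue; apply: val_inj.
rewrite [LHS]vr_valM [RHS]vr_val1 vr_val_inv ?mulVf //.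
Qed.

Lemma residue_inv0 : residue_inv 0 = 0.
Proof. by rewrite /residue_inv eqxx. Qed.

HB.instance Definition _ :=
  GRing.ComNzRing_isField.Build residue_field residue_mulVf residue_inv0.

Lemma base_val_ge0 c : f c \in val_ge0.
Proof.
rewrite /val_ge0 /in_mem /=; have [->|c0] := eqVneq c 0.
  by rewrite rmorph0 eqxx.
by rewrite val_base // lexx orbT.
Qed.

Definition residue_base (c : k) : residue_field :=
  residue (ValuationRing (base_val_ge0 c)).

Lemma residue_base_zmod_morphism : zmod_morphism residue_base.
Proof.
move=> c d; rewrite /residue_base -rmorphB; congr residue; apply: val_inj.
by rewrite (raddfB (val : valuation_ring -> K)) /= rmorphB.
Qed.

Lemma residue_base_monoid_morphism : monoid_morphism residue_base.
Proof.
split=> [|c d]; rewrite /residue_base.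
  rewrite -(rmorph1 residue); congr residue; apply: val_inj.
  by rewrite (rmorph1 (val : valuation_ring -> K)) /= rmorph1.
rewrite -rmorphM; congr residue; apply: val_inj.
by rewrite (rmorphM (val : valuation_ring -> K)) /= rmorphM.
Qed.

HB.instance Definition _ :=
  GRing.isZmodMorphism.Build k residue_field residue_base
    residue_base_zmod_morphism.
HB.instance Definition _ :=
  GRing.isMonoidMorphism.Build k residue_field residue_base
    residue_base_monoid_morphism.

Definition abhyankar : Prop :=
  exists r d : nat,
    [/\ dimQ (tensorQ value_group) r, trdeg residue_base d & trdeg f (r + d)].

Definition centered (A : comNzRingType) (iota : {rmorphism A -> K})
    (m : set A) : Prop :=
  (forall a, iota a \in val_ge0) /\ m = [set a | iota a \in val_gt0].

End ValuationTheory.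

(* Main.v *)
(* Positive volume proof of an Izumi type inequality.  If w is centered on m   *)
(* then w is at least a positive multiple of the m-adic order on A, so it      *)
(* suffices to bound v above by a multiple of the order.  Lift a transcendence *)
(* basis of A/m over k to t in A; then P = k[t] has its nonzero elements       *)
(* invertible in A, and "dimension" means rank over P.  Since v is Abhyankar,  *)
(* there are N = r + (d - #t) >= dim A elements of K (r of them with           *)
(* independent values, the others with residues independent over P) whose      *)
(* T^N monomials with exponents < T, times a common denominator, have nonzero  *)
(* P-combinations of value at most c T: the colength of {v > c T} is at least  *)
(* T^N.  If z of order n satisfied v(z) > c T, rewriting the leading monomial  *)
(* of z would bound this colength by O(n T^(dim A - 1)), so T = O(n).          *)
(* Transcendence degrees are compared by the same kind of counting.            *)

From HB Require Import structures.
Require Import Defs.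
From mathcomp Require Import all_boot all_order all_algebra.
From mathcomp Require Import boolp classical_sets reals.
From mathcomp Require Import mpoly.
From mathcomp Require Import zify ring.

Set Implicit Arguments.
Unset Strict Implicit.
Unset Printing Implicit Defensive.

Import Order.TTheory GRing.Theory Num.Theory.
Local Open Scope classical_set_scope.
Local Open Scope ring_scope.

(** * Linear dependence and box monomials *)

Lemma fraction_numden (P : idomainType) (z : {fraction P}) :
  exists nd : P * P, nd.2 != 0 /\ z * tofrac nd.2 = tofrac nd.1.
Proof.
rewrite -[z]reprK; set x := repr z; exists (\n_x, \d_x) => /=; split; first exact: denom_ratioP.
unlock FracField.tofrac; rewrite -[LHS]FracField.pi_mul.
apply/eqmodP => /=; rewrite FracField.equivfE /FracField.mulf /=.
have d0 : \d_x * 1 != 0 by rewrite mulr1 denom_ratioP.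
by rewrite !numden_Ratio ?oner_neq0 // !mulr1 mulrC.
Qed.

Lemma field_dependent (F : fieldType) m n (c : 'M[F]_(m, n)) :
  (n < m)%N -> exists2 u : 'rV_m, u != 0 & u *m c = 0.
Proof.
move=> nm; have : kermx c != 0.
  by rewrite -mxrank_eq0 mxrank_ker subn_eq0 -ltnNge (leq_ltn_trans (rank_leq_col c)).
case/rowV0Pn => u uker u0; exists u => //; exact/sub_kermxP.
Qed.

Lemma idomain_dependent (P : idomainType) (I S : finType) (c : I -> S -> P) :
  (#|S| < #|I|)%N ->
  exists u : I -> P, (exists i, u i != 0) /\ forall s, \sum_i u i * c i s = 0.
Proof.
move=> SI.
pose C : 'M[{fraction P}]_(#|I|, #|S|) :=
  \matrix_(i, s) tofrac (c (enum_val i) (enum_val s)).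
have [u u0 uC] := field_dependent C SI.
have [nd nd_P] := choice (@fraction_numden P).
pose num i := (nd (u 0 i)).1; pose den i := (nd (u 0 i)).2.
have den0 i : den i != 0 by have [] := nd_P (u 0 i).
have numE i : u 0 i * tofrac (den i) = tofrac (num i) by have [] := nd_P (u 0 i).
pose t i := num i * \prod_(j | j != i) den j.
have tE i : tofrac (t i) = u 0 i * tofrac (\prod_j den j).
  by rewrite /t tofracM -numE -mulrA -tofracM [in RHS](bigD1 i).
have d0 : \prod_j den j != 0 by apply/prodf_neq0 => j _.
exists (fun i => t (enum_rank i)); split.
  have [i ui] := rV0Pn _ u0; exists (enum_val i).
  by rewrite enum_valK -tofrac_eq0 tE mulf_neq0 ?tofrac_eq0.
move=> s; apply/eqP; rewrite -tofrac_eq0 rmorph_sum /=.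
have /matrixP/(_ 0 (enum_rank s)) := uC; rewrite !mxE => uCs.
rewrite (reindex (@enum_val _ I)) /=; last by apply: onW_bij; exact: enum_val_bij.
under eq_bigr => i _ do rewrite enum_valK rmorphM /= tE mulrAC.
rewrite -mulr_suml.
suff -> : \sum_i u 0 i * tofrac (c (enum_val i) s) = 0 by rewrite mul0r.
by rewrite -[RHS]uCs; apply: eq_bigr => i _; rewrite mxE enum_rankK.
Qed.

Section BoxMonomials.
Variables (R : comNzRingType) (n : nat).

Definition mon (B : nat) (x : 'I_n -> R) (e : {ffun 'I_n -> 'I_B}) : R :=
  \prod_(i < n) x i ^+ e i.

Definition mnm_of (B : nat) (e : {ffun 'I_n -> 'I_B}) : 'X_{1..n} :=
  [multinom (e i : nat) | i < n].

Lemma mnm_of_inj B : injective (@mnm_of B).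
Proof.
move=> e f /mnmP ef; apply/ffunP => i; apply: val_inj => /=.
by have := ef i; rewrite !mnmE.
Qed.

Lemma mmap1_mnm_of B (x : 'I_n -> R) (e : {ffun 'I_n -> 'I_B}) :
  mmap1 x (mnm_of e) = mon x e.
Proof. by apply: eq_bigr => i _; rewrite mnmE. Qed.

End BoxMonomials.

Section BoxPolynomials.
Variables (P R : comNzRingType) (h : {rmorphism P -> R}) (n : nat).

Definition boxpoly (B : nat) (c : {ffun 'I_n -> 'I_B} -> P) : {mpoly P[n]} :=
  \sum_e c e *: 'X_[mnm_of e].

Lemma mcoeff_boxpoly B (c : {ffun 'I_n -> 'I_B} -> P) e :
  (boxpoly c)@_(mnm_of e) = c e.
Proof.
rewrite /boxpoly raddf_sum (bigD1 e) //= big1 => [|f fe].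
  by rewrite mcoeffZ mcoeffX eqxx mulr1 addr0.
by rewrite mcoeffZ mcoeffX (inj_eq (@mnm_of_inj n B)) (negbTE fe) mulr0.
Qed.

Lemma mmap_boxpoly B (x : 'I_n -> R) (c : {ffun 'I_n -> 'I_B} -> P) :
  mmap h x (boxpoly c) = \sum_e h (c e) * mon x e.
Proof.
rewrite /boxpoly raddf_sum /=; apply: eq_bigr => e _.
by rewrite mmapZ mmapX mmap1_mnm_of.
Qed.

Lemma boxpoly_mcoeff B (p : {mpoly P[n]}) :
  (msize p <= B)%N -> p = boxpoly (fun e : {ffun 'I_n -> 'I_B} => p@_(mnm_of e)).
Proof.
move=> pB; apply/mpolyP => m.
have [mB|mB] := boolP [forall i, (m i < B)%N].
  pose e : {ffun 'I_n -> 'I_B} := [ffun i => Ordinal (forallP mB i)].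
  have -> : m = mnm_of e by apply/mnmP => i; rewrite mnmE ffunE.
  by rewrite mcoeff_boxpoly.
rewrite memN_msupp_eq0; last first.
  apply: contra mB => /msize_mdeg_lt mp; apply/forallP => i.
  apply: leq_trans pB; apply: leq_ltn_trans mp.
  by rewrite mdegE (bigD1 i) //= leq_addr.
rewrite /boxpoly raddf_sum big1 //= => e _.
rewrite mcoeffZ mcoeffX; case: eqP => [em|]; last by rewrite mulr0.
by case/negP: mB; apply/forallP => i; rewrite -em mnmE.
Qed.

Lemma mmap_boxE B (x : 'I_n -> R) (p : {mpoly P[n]}) : (msize p <= B)%N ->
  mmap h x p = \sum_(e : {ffun 'I_n -> 'I_B}) h p@_(mnm_of e) * mon x e.
Proof. by move=> /boxpoly_mcoeff {1}->; rewrite mmap_boxpoly. Qed.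

End BoxPolynomials.

Section Reduction.
Variables (L : comNzRingType) (W : nat -> set L).
Hypothesis W0 : forall M, W M 0.
Hypothesis W1 : W 1%N 1.
Hypothesis WD : forall M a b, W M a -> W M b -> W M (a + b).
Hypothesis WM : forall M N a b, W M a -> W N b -> W (M + N)%N (a * b).

Lemma filtered_exp C a d : W C a -> W (C * d + 1)%N (a ^+ d).
Proof.
move=> Wa; elim: d => [|d IH]; first by rewrite muln0 expr0.
by rewrite exprS mulnS -addnA; apply: WM.
Qed.

Lemma reduce_power N C (y q : L) (p : nat -> L) (b : nat) :
    W C q -> (forall i, W C (p i)) ->
    q * y ^+ N.+1 = \sum_(i < N.+1) p i * y ^+ i ->
  exists a : nat -> L, (forall i, W (C * b + 1)%N (a i)) /\
    q ^+ b * y ^+ b = \sum_(i < N.+1) a i * y ^+ i.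
Proof.
move=> Wq Wp qy; elim: b => [|b [a [Wa abE]]].
  exists (fun i => (i == 0%N)%:R); split.
    by move=> i; rewrite muln0; case: (i == _).
  rewrite big_ord_recl big1 ?addr0 ?mulr1 ?expr0 ?mul1r //= => i _.
  by rewrite mul0r.
exists (fun i => (if i is i'.+1 then q * a i' else 0) + a N * p i); split.
  move=> i; rewrite mulnS -addnA; apply: WD; last by rewrite addnC; apply: WM.
  by case: i => [|i]; [exact: W0 | exact: WM].
under eq_bigr => i _ do rewrite mulrDl -mulrA.
rewrite big_split /= -mulr_sumr -qy big_ord_recl mul0r add0r.
rewrite !exprS mulrACA abE mulr_sumr big_ord_recr /= mulrACA [q * a N]mulrC -!mulrA.
rewrite -!exprS; congr (_ + _); apply: eq_bigr => i _.
by rewrite /bump leq0n add0n add1n exprS -!mulrA [y * (a i * _)]mulrCA.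
Qed.

Lemma reduce_power_le N C (y q : L) (p : nat -> L) (b B : nat) : (b <= B)%N ->
    W C q -> (forall i, W C (p i)) ->
    q * y ^+ N.+1 = \sum_(i < N.+1) p i * y ^+ i ->
  exists a : nat -> L, (forall i, W (C * B + 2)%N (a i)) /\
    q ^+ B * y ^+ b = \sum_(i < N.+1) a i * y ^+ i.
Proof.
move=> bB Wq Wp qy; have [a [Wa abE]] := reduce_power b Wq Wp qy.
exists (fun i => q ^+ (B - b) * a i); split.
  move=> i; have -> : (C * B + 2 = (C * (B - b) + 1) + (C * b + 1))%N.
    by rewrite addnACA -mulnDr subnK.
  by apply: WM => //; apply: filtered_exp.
under eq_bigr => i _ do rewrite -mulrA.
by rewrite -mulr_sumr -abE mulrA -exprD subnK.
Qed.

Lemma reduce_monomial s N C (y q : 'I_s -> L) (p : 'I_s -> nat -> L) B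
    (b : {ffun 'I_s -> 'I_B}) :
    (forall j, W C (q j)) -> (forall j i, W C (p j i)) ->
    (forall j, q j * y j ^+ N.+1 = \sum_(i < N.+1) p j i * y j ^+ i) ->
  exists a : {ffun 'I_s -> 'I_N.+1} -> L,
    (forall g, W (s * (C * B + 2) + 1)%N (a g)) /\
    (\prod_j q j) ^+ B * mon y b = \sum_g a g * mon y g.
Proof.
move=> Wq Wp qy.
have /choice[a aP] : forall j, exists a : nat -> L,
    (forall i, W (C * B + 2)%N (a i)) /\
    q j ^+ B * y j ^+ b j = \sum_(i < N.+1) a i * y j ^+ i.
  by move=> j; apply: reduce_power_le (Wp j) (qy j) => //; apply: ltnW.
exists (fun g : {ffun 'I_s -> 'I_N.+1} => \prod_j a j (g j)); split.
  move=> g; have -> : (s * (C * B + 2) = \sum_(j < s) (C * B + 2))%N.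
    by rewrite sum_nat_const card_ord.
  apply: (big_rec2 (fun (d : nat) (z : L) => W (d + 1)%N z)) => [//|j d z _ Wz].
  by rewrite -addnA; apply: WM => //; case: (aP j).
rewrite -prodrXl /mon -big_split /=.
under eq_bigr => j _ do rewrite (aP j).2.
by rewrite bigA_distr_bigA /=; apply: eq_bigr => g _; rewrite big_split.
Qed.

End Reduction.

Lemma lead_relation (L : fieldType) (V : set L) s (y : 'I_s -> L) :
    V 0 -> (forall a, V a -> V (- a)) ->
    (forall j, exists F : {poly L}, [/\ F != 0, forall i, V F`_i & root F (y j)]) ->
  exists N (q : 'I_s -> L) (p : 'I_s -> nat -> L),
    [/\ forall j, q j != 0 /\ V (q j), forall j i, V (p j i),
        forall j i, (N < i)%N -> p j i = 0 &
        forall j, q j * y j ^+ N.+1 = \sum_(i < N.+1) p j i * y j ^+ i].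
Proof.
move=> V0 VN /choice[F FP].
pose N := \max_j size (F j).
pose G j := F j * 'X^(N.+2 - size (F j)).
have FN j : (size (F j) <= N)%N by apply: (@leq_bigmax_cond _ xpredT (fun j => size (F j))).
have F0 j : F j != 0 by have [] := FP j.
have sG j : size (G j) = N.+2.
  rewrite /G size_mulXn // subnK //; apply: leq_trans (FN j) _.
  by rewrite -addn2 leq_addr.
have GV j i : V (G j)`_i.
  by rewrite /G coefMXn; case: ifP => // _; have [] := FP j.
exists N, (fun j => (G j)`_N.+1), (fun j i => if (N < i)%N then 0 else - (G j)`_i).
split=> [j|j i|j i ->|j] //; first split=> //.
- have : lead_coef (G j) != 0 by rewrite lead_coef_eq0 -size_poly_eq0 sG.
  by rewrite lead_coefE sG.
- by case: ifP => // _; apply: VN.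
have [_ _ /rootP Fy] := FP j.
have : (G j).[y j] = 0 by rewrite hornerM Fy mul0r.
rewrite horner_coef sG big_ord_recr /= => /eqP; rewrite addrC addr_eq0 => /eqP ->.
rewrite -sumrN; apply: eq_bigr => i _.
by rewrite ltnNge -ltnS ltn_ord mulNr.
Qed.

Section PolynomialValues.
Variables (k L : fieldType) (f : {rmorphism k -> L}) (n : nat) (x : 'I_n -> L).

Definition pol_le (M : nat) : set L :=
  [set z | exists2 p : {mpoly k[n]}, (msize p <= M)%N & z = mmap f x p].

Definition pol_val : set L := [set z | exists M, pol_le M z].

Lemma pol_le_mono M N : (M <= N)%N -> pol_le M `<=` pol_le N.
Proof. by move=> MN z [p pM ->]; exists p => //; apply: leq_trans MN. Qed.

Lemma pol_le0 M : pol_le M 0.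
Proof. by exists 0; rewrite ?msize0 ?raddf0. Qed.

Lemma pol_leC c : pol_le 1 (f c).
Proof. by exists c%:MP; rewrite ?mmapC // mmeasureC; case: (c == 0). Qed.

Lemma pol_leX i : pol_le 2 (x i).
Proof. by exists 'X_i; rewrite ?msizeX ?mdeg1 // mmapX mmap1U. Qed.

Lemma pol_leD M a b : pol_le M a -> pol_le M b -> pol_le M (a + b).
Proof.
move=> [p pM ->] [q qM ->]; exists (p + q); last by rewrite rmorphD.
by apply: leq_trans (mmeasureD_le _ _ _) _; rewrite geq_max pM.
Qed.

Lemma pol_leM M N a b : pol_le M a -> pol_le N b -> pol_le (M + N) (a * b).
Proof.
move=> [p pM ->] [q qN ->]; exists (p * q); last by rewrite rmorphM.
have [->|p0] := eqVneq p 0; first by rewrite mul0r msize0.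
have [->|q0] := eqVneq q 0; first by rewrite mulr0 msize0.
by rewrite msizeM //; apply: leq_trans (leq_pred _) (leq_add pM qN).
Qed.

Lemma pol_val_base c : pol_val (f c).
Proof. by exists 1%N; apply: pol_leC. Qed.

Lemma pol_val0 : pol_val 0.
Proof. by exists 0%N; apply: pol_le0. Qed.

Lemma pol_le1 : pol_le 1 1.
Proof. by have := pol_leC 1; rewrite rmorph1. Qed.

Lemma pol_val1 : pol_val 1.
Proof. by exists 1%N; apply: pol_le1. Qed.

Lemma pol_val_gen i : pol_val (x i).
Proof. by exists 2%N; apply: pol_leX. Qed.

Lemma pol_valD a b : pol_val a -> pol_val b -> pol_val (a + b).
Proof.
move=> [M aM] [N bN]; exists (maxn M N).
by apply: pol_leD; [apply: pol_le_mono aM | apply: pol_le_mono bN];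
   rewrite ?leq_maxl ?leq_maxr.
Qed.

Lemma pol_valM a b : pol_val a -> pol_val b -> pol_val (a * b).
Proof. by move=> [M aM] [N bN]; exists (M + N)%N; apply: pol_leM. Qed.

Lemma pol_valN a : pol_val a -> pol_val (- a).
Proof. by move=> [M [p pM ->]]; exists M, (- p); rewrite ?mmeasureN // raddfN. Qed.

Lemma pol_val_sum (I : finType) (F : I -> L) :
  (forall i, pol_val (F i)) -> pol_val (\sum_i F i).
Proof.
move=> FP; apply: (big_ind pol_val) => //; [exact: pol_val0 | exact: pol_valD].
Qed.

Lemma pol_val_prod (I : finType) (F : I -> L) :
  (forall i, pol_val (F i)) -> pol_val (\prod_i F i).
Proof.
move=> FP; apply: (big_ind pol_val) => //; [exact: pol_val1 | exact: pol_valM].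
Qed.

Lemma pol_val_exp a d : pol_val a -> pol_val (a ^+ d).
Proof.
move=> aP; elim: d => [|d IH]; last by rewrite exprS; apply: pol_valM.
by rewrite expr0; apply: pol_val1.
Qed.

Lemma pol_val_bound (I : finType) (F : I -> nat -> L) (N : nat) :
    (forall j i, (N <= i)%N -> F j i = 0) -> (forall j i, pol_val (F j i)) ->
  exists C, forall j i, pol_le C (F j i).
Proof.
move=> F0 FP.
have /choice[C CP] : forall ji : I * 'I_N, exists C, pol_le C (F ji.1 ji.2).
  by move=> [j i]; have [M] := FP j i; exists M.
exists (\max_ji C ji) => j i; have [Ni|iN] := leqP N i.
  by rewrite F0 //; apply: pol_le0.
have := CP (j, Ordinal iN); apply: pol_le_mono.
exact: (@leq_bigmax_cond _ xpredT C (j, Ordinal iN)).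
Qed.

Definition algebraic_pol (z : L) : Prop :=
  exists F : {poly L}, [/\ F != 0, forall i, pol_val F`_i & root F z].

(* The M^s monomials in y with exponents < M lie, up to a common denominator, *)
(* in a k-space of dimension O(M^n).                                          *)
Lemma algebraic_dependent s (y : 'I_s -> L) :
    (n < s)%N -> (forall j, algebraic_pol (y j)) ->
  exists B (c : {ffun 'I_s -> 'I_B} -> k),
    (exists e, c e != 0) /\ \sum_e f (c e) * mon y e = 0.
Proof.
move=> ns /(lead_relation pol_val0 pol_valN)[N [q [p [qV pV pN qy]]]].
have [C1 C1P] := pol_val_bound pN (fun j i => pV j i).
have [C2 C2P] : exists C, forall j, pol_le C (q j).
  have [||C CP] := @pol_val_bound _ (fun j i => if i is 0 then q j else 0) 1%N.
  - by move=> j [].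
  - by move=> j [|i]; [have [] := qV j | exact: pol_val0].
  by exists C => j; apply: (CP j 0%N).
pose C := maxn C1 C2.
have Wp j i : pol_le C (p j i) by apply: pol_le_mono (C1P j i); apply: leq_maxl.
have Wq j : pol_le C (q j) by apply: pol_le_mono (C2P j); apply: leq_maxr.
pose E0 := (s * (C + 2) + 1)%N; pose M := (E0 ^ n * N.+1 ^ s).+1.
pose E := (s * (C * M + 2) + 1)%N.
have /choice[a aP] := fun b : {ffun 'I_s -> 'I_M} =>
  reduce_monomial pol_le0 pol_le1 pol_leD pol_leM b Wq Wp qy.
have /choice[d dP] : forall bg : {ffun 'I_s -> 'I_M} * {ffun 'I_s -> 'I_N.+1},
    exists d : {ffun 'I_n -> 'I_E} -> k, a bg.1 bg.2 = \sum_e f (d e) * mon x e.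
  move=> [b g] /=; have [/(_ g)[P PE ->] _] := aP b.
  by rewrite (mmap_boxE f x PE); exists (fun e => P@_(mnm_of e)).
have EM : (E <= M * E0)%N by rewrite /E /E0; nia.
pose S : finType := ({ffun 'I_n -> 'I_E} * {ffun 'I_s -> 'I_N.+1})%type.
have cards : (#|{: S}| < #|{ffun 'I_s -> 'I_M}|)%N.
  rewrite card_prod !card_ffun !card_ord.
  apply: (@leq_ltn_trans (M ^ n * (E0 ^ n * N.+1 ^ s))).
    rewrite mulnA -expnMn leq_mul //.
    by case: (posnP n) => [->|n0]; rewrite ?expn0 ?leq_exp2r.
  apply: (@leq_trans (M ^ n.+1)); last by rewrite leq_pexp2l.
  by rewrite expnSr ltn_pmul2l ?expn_gt0.
have [u [u0 uE]] := idomain_dependent (fun b (eg : S) => d (b, eg.2) eg.1) cards.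
exists M, u; split=> //.
have Q0 : (\prod_j q j) ^+ M != 0.
  by apply: expf_neq0; apply/prodf_neq0 => j _; have [] := qV j.
apply: (mulfI Q0); rewrite mulr0 mulr_sumr.
transitivity (\sum_b \sum_(eg : S) f (u b * d (b, eg.2) eg.1) * (mon x eg.1 * mon y eg.2)).
  apply: eq_bigr => b _; rewrite mulrCA (aP b).2 mulr_sumr.
  rewrite -(pair_big xpredT xpredT (fun e g => f (u b * d (b, g) e) * (mon x e * mon y g))) /=.
  rewrite exchange_big /=; apply: eq_bigr => g _.
  rewrite (dP (b, g)) mulr_suml mulr_sumr; apply: eq_bigr => e _.
  by rewrite rmorphM -!mulrA.
rewrite exchange_big big1 //= => eg _.
by rewrite -mulr_suml -rmorph_sum /= uE rmorph0 mul0r.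
Qed.

End PolynomialValues.

(** * Free families *)

Section FreeFamilies.
Variables (P A : comNzRingType) (h : {rmorphism P -> A}).

(* For Q = 0 this is algebraic independence over P, in box coordinates. *)
Definition free_mod (Q : set A) n (x : 'I_n -> A) : Prop :=
  forall B (c : {ffun 'I_n -> 'I_B} -> P),
    Q (\sum_e h (c e) * mon x e) -> forall e, c e = 0.

Definition xcons n (z : A) (x : 'I_n -> A) : 'I_n.+1 -> A :=
  fun j => if unlift ord0 j is Some j' then x j' else z.

Definition fcons n B (i : 'I_B) (e : {ffun 'I_n -> 'I_B}) : {ffun 'I_n.+1 -> 'I_B} :=
  [ffun j => if unlift ord0 j is Some j' then e j' else i].

Lemma fconsP n B (e : {ffun 'I_n.+1 -> 'I_B}) :
  fcons (e ord0) [ffun j => e (lift ord0 j)] = e.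
Proof.
apply/ffunP => j; rewrite ffunE.
by case: (unliftP ord0 j) => [j' ->|->] //; rewrite ffunE.
Qed.

Lemma mon_cons n B z (x : 'I_n -> A) (i : 'I_B) (e : {ffun 'I_n -> 'I_B}) :
  mon (xcons z x) (fcons i e) = z ^+ i * mon x e.
Proof.
rewrite /mon big_ord_recl /xcons /fcons ffunE unlift_none; congr (_ * _).
by apply: eq_bigr => j _; rewrite ffunE liftK.
Qed.

Lemma sum_fcons n B (F : {ffun 'I_n.+1 -> 'I_B} -> A) :
  \sum_e F e = \sum_i \sum_e F (fcons i e).
Proof.
rewrite pair_big /= (reindex (fun ie : 'I_B * {ffun 'I_n -> 'I_B} => fcons ie.1 ie.2)) //.
exists (fun e : {ffun 'I_n.+1 -> 'I_B} => (e ord0, [ffun j => e (lift ord0 j)])).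
  move=> [i e] _; rewrite /fcons ffunE unlift_none; congr pair.
  by apply/ffunP => j; rewrite !ffunE liftK.
by move=> e _; apply: fconsP.
Qed.

Lemma sum_mon_cons n B z (x : 'I_n -> A) (c : {ffun 'I_n.+1 -> 'I_B} -> P) :
  \sum_e h (c e) * mon (xcons z x) e =
  \sum_i (\sum_e h (c (fcons i e)) * mon x e) * z ^+ i.
Proof.
rewrite sum_fcons; apply: eq_bigr => i _; rewrite mulr_suml.
by apply: eq_bigr => e _; rewrite mon_cons mulrCA mulrC.
Qed.

Lemma not_free_mod_cons (Q : set A) n z (x : 'I_n -> A) :
    ~ free_mod Q (xcons z x) ->
  exists B (c : 'I_B -> {ffun 'I_n -> 'I_B} -> P),
    (exists i e, c i e != 0) /\
    Q (\sum_i (\sum_e h (c i e) * mon x e) * z ^+ i).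
Proof.
move=> /existsNP[B] /existsNP[c] /not_implyP[Qc] /existsNP[e /eqP ce].
exists B, (fun i e => c (fcons i e)); split; last by rewrite -sum_mon_cons.
by exists (e ord0), [ffun j => e (lift ord0 j)]; rewrite fconsP.
Qed.

Lemma free_mod_mmap (Q : set A) n (x : 'I_n -> A) (p : {mpoly P[n]}) :
  free_mod Q x -> Q (mmap h x p) -> p = 0.
Proof.
move=> xfree Qp; have pE := boxpoly_mcoeff (leqnn (msize p)).
rewrite (mmap_boxE h x (leqnn _)) in Qp.
by rewrite pE; apply: big1 => e _ /=; rewrite (xfree _ _ Qp) scale0r.
Qed.

Lemma free_mod_nil (Q : set A) (x : 'I_0 -> A) :
  (forall c, Q (h c) -> c = 0) -> free_mod Q x.
Proof.
move=> hQ B c Qc e; apply: hQ; congr Q: Qc.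
rewrite (bigD1 e) //= big1 ?addr0 => [|g /eqP[]]; last by apply/ffunP => -[].
by rewrite /mon big_ord0 mulr1.
Qed.

Lemma free_mod_sub (Q Q' : set A) n (x : 'I_n -> A) :
  Q `<=` Q' -> free_mod Q' x -> free_mod Q x.
Proof. by move=> QQ' xfree B c /QQ'; apply: xfree. Qed.

Lemma ideal_sum (Q : set A) (I : finType) (F : I -> A) :
  is_ideal Q -> (forall i, Q (F i)) -> Q (\sum_i F i).
Proof. by move=> [Q0 QD _] QF; apply: (big_ind Q). Qed.

Lemma prime_exp (Q : set A) z d T : is_prime Q -> ~ Q z -> Q (z ^+ d * T) -> Q T.
Proof.
move=> [_ _ Qprime] Qz; elim: d => [|d IH]; first by rewrite expr0 mul1r.
by rewrite exprS -mulrA => /Qprime[].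
Qed.

Lemma free_mod_prime_step (Q Q' : set A) n z (x : 'I_n -> A) :
    is_prime Q -> is_ideal Q' -> Q `<=` Q' -> Q' z -> ~ Q z ->
  free_mod Q' x -> free_mod Q (xcons z x).
Proof.
move=> Qprime Q'ideal QQ' Q'z Qz xfree B c; rewrite sum_mon_cons.
set S := fun i : 'I_B => \sum_e h (c (fcons i e)) * mon x e.
move=> Qsum; suff cons0 (b : nat) : forall i : 'I_B, (i < b)%N ->
    forall e, c (fcons i e) = 0.
  by move=> e; rewrite -(fconsP e) (cons0 B).
elim: b => // b IH i; rewrite ltnS leq_eqVlt => /predU1P[ib|]; last exact: IH.
apply: xfree; rewrite -/(S i); have [_ Q'D Q'M] := Q'ideal.
pose T (j : 'I_B) := if (j < i)%N then 0 else S j * z ^+ (j - i).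
have TE : \sum_j S j * z ^+ j = z ^+ i * \sum_j T j.
  rewrite mulr_sumr; apply: eq_bigr => j _; rewrite /T; case: ltnP => ji.
    rewrite mulr0 [S j]big1 ?mul0r // => e _.
    by rewrite IH ?rmorph0 ?mul0r // -ib.
  by rewrite mulrCA -exprD subnKC.
move: Qsum; rewrite TE => /(prime_exp Qprime Qz)/QQ'.
rewrite (bigD1 i) //= {1}/T ltnn subnn mulr1; set R := \sum_(j | j != i) _ => Q'SR.
suff Q'R : Q' R by have := Q'D _ _ Q'SR (Q'M (-1) _ Q'R); rewrite mulN1r addrK.
rewrite /R big_mkcond; apply: ideal_sum => // j; case: ifP => [ji|_]; last by case: Q'ideal.
rewrite /T; case: ltnP => [_|ij]; first by case: Q'ideal.
have : (0 < j - i)%N by rewrite subn_gt0 ltn_neqAle ij andbT eq_sym (inj_eq val_inj) ji.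
by case: (j - i)%N => // d _; rewrite exprSr mulrA; apply: Q'M.
Qed.

Lemma free_mod_prime_chain (Q : nat -> set A) D t (x : 'I_t -> A) :
    (forall i, (i <= D)%N -> is_prime (Q i)) ->
    (forall i, (i < D)%N -> Q i `<` Q i.+1) ->
  free_mod (Q D) x -> exists y : 'I_(D + t) -> A, free_mod (Q 0%N) y.
Proof.
move=> Qprime Qlt xfree.
suff H d : (d <= D)%N -> exists y : 'I_(d + t) -> A, free_mod (Q (D - d)%N) y.
  by have := H D (leqnn D); rewrite subnn.
elim: d => [_|d IH dD]; first by exists x; rewrite subn0.
have [y yfree] := IH (ltnW dD).
have ltD : (D - d.+1 < D)%N by lia.
have := Qlt _ ltD; have -> : (D - d.+1).+1 = (D - d)%N by lia.
move=> [QQ' /existsNP[z /not_implyP[Q'z Qz]]].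
exists (xcons z y); apply: free_mod_prime_step yfree => //; first exact/Qprime/ltnW.
by have [] := Qprime (D - d)%N (leq_subr _ _).
Qed.

End FreeFamilies.

Lemma free_mod_comp (P A L : comNzRingType) (h : {rmorphism P -> A})
    (g : {rmorphism A -> L}) (Q : set L) n (x : 'I_n -> A) :
  free_mod h (g @^-1` Q) x <-> free_mod (g \o h) Q (g \o x).
Proof.
have E B c : \sum_(e : {ffun 'I_n -> 'I_B}) (g \o h) (c e) * mon (g \o x) e =
    g (\sum_e h (c e) * mon x e).
  rewrite rmorph_sum; apply: eq_bigr => e _ /=; rewrite rmorphM; congr (_ * _).
  by rewrite rmorph_prod; apply: eq_bigr => i _ /=; rewrite rmorphXn.
split=> xfree B c Qc; apply: xfree.
  by rewrite /preimage /= -E.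
by rewrite E.
Qed.

Section FieldExtension.
Variables (k L : fieldType) (f : {rmorphism k -> L}).

Lemma alg_independentE n (x : 'I_n -> L) :
  alg_independent f x <-> free_mod f [set 0] x.
Proof.
split=> [xind B c xc e|xfree p xp]; last exact: (free_mod_mmap xfree).
by rewrite -(mcoeff_boxpoly c) (xind (boxpoly c)) ?mcoeff0 // mmap_boxpoly.
Qed.

Lemma free_algebraic_le n (x : 'I_n -> L) s (y : 'I_s -> L) :
  free_mod f [set 0] y -> (forall i, algebraic_pol f x (y i)) -> (s <= n)%N.
Proof.
move=> yfree yalg; rewrite leqNgt; apply/negP => ns.
have [B [c [[e ce] c0]]] := algebraic_dependent ns yalg.
by rewrite (yfree _ _ c0) eqxx in ce.
Qed.

Lemma algebraic_adjoin n (x : 'I_n -> L) z :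
  algebraic_over_set (adjoin f x) z -> algebraic_pol f x z.
Proof.
move=> [F [F0 FE Fz]].
have /choice[pq pqP] : forall i, exists pq : {mpoly k[n]} * {mpoly k[n]},
    mmap f x pq.2 != 0 /\ F`_i = mmap f x pq.1 / mmap f x pq.2.
  by move=> i; have [p [q pqi]] := FE i; exists (p, q).
have pv (p : {mpoly k[n]}) : pol_val f x (mmap f x p) by exists (msize p); exists p.
pose d := \prod_(i < size F) mmap f x (pq i).2.
have d0 : d != 0 by apply/prodf_neq0 => i _; have [] := pqP i.
exists (d *: F); split; first by rewrite scaler_eq0 negb_or d0.
  move=> i; rewrite coefZ; have [Fi|iF] := leqP (size F) i.
    by rewrite nth_default // mulr0; apply: pol_val0.
  have [q0 ->] := pqP i; rewrite /d (bigD1 (Ordinal iF)) //= mulrAC mulrCA.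
  rewrite mulfV // mulr1 big_mkcond; apply: pol_valM; first exact: pv.
  by apply: pol_val_prod => j; case: ifP => _; [exact: pv | exact: pol_val1].
by rewrite /root hornerZ (rootP Fz) mulr0.
Qed.

Lemma trdeg_free_le n s (y : 'I_s -> L) :
  trdeg f n -> free_mod f [set 0] y -> (s <= n)%N.
Proof.
move=> [x [_ xalg]] yfree; apply: free_algebraic_le yfree _ => i.
exact/algebraic_adjoin/xalg.
Qed.

Lemma pol_val_trans n (x : 'I_n -> L) n' (x' : 'I_n' -> L) z :
  (forall i, pol_val f x' (x i)) -> pol_val f x z -> pol_val f x' z.
Proof.
move=> xx' [M [p pM ->]]; rewrite (mmap_boxE f x pM); apply: pol_val_sum => e.
apply: pol_valM; first exact: pol_val_base.
by apply: pol_val_prod => i; apply: pol_val_exp.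
Qed.

Lemma free_extend (P : comNzRingType) (h : {rmorphism P -> L}) n (x : 'I_n -> L)
    s (y : 'I_s -> L) d (T : 'I_d -> L) :
    (forall c, pol_val f x (h c)) -> free_mod h [set 0] y ->
    free_mod f [set 0] T -> (n + s < d)%N ->
  exists z, free_mod h [set 0] (xcons z y).
Proof.
move=> hx yfree Tfree; apply: contraPP => /forallNP nz.
apply/negP; rewrite -leqNgt.
pose xy (i : 'I_(n + s)) := match split i with inl a => x a | inr b => y b end.
have xv i : pol_val f xy (x i).
  have -> : x i = xy (unsplit (inl i)) by rewrite /xy unsplitK.
  exact: pol_val_gen.
have yv i : pol_val f xy (y i).
  have -> : y i = xy (unsplit (inr i)) by rewrite /xy unsplitK.
  exact: pol_val_gen.
apply: (free_algebraic_le (x := xy) Tfree) => i.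
have [B [c [[i0 [e0 c0]] cT]]] := not_free_mod_cons (nz (T i)).
pose S j := \sum_e h (c j e) * mon y e.
pose F := \poly_(j < B) (if insub j is Some j' then S j' else 0).
have FS (j : 'I_B) : F`_j = S j by rewrite coef_poly ltn_ord valK.
exists F; split.
- apply: contra_neq c0 => F0; apply: (yfree B (c i0)).
  by rewrite -/(S i0) -FS F0 coef0.
- move=> j; rewrite coef_poly; case: ifP => _; last exact: pol_val0.
  case: insub => [j'|]; last exact: pol_val0.
  apply: pol_val_sum => e; apply: pol_valM; first exact: pol_val_trans (hx _).
  by apply: pol_val_prod => l; apply: pol_val_exp.
- rewrite /root horner_poly -[X in _ == X]cT; apply/eqP; apply: eq_bigr => j _.
  by rewrite valK.
Qed.

Lemma free_extend_full (P : comNzRingType) (h : {rmorphism P -> L}) n (x : 'I_n -> L)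
    d (T : 'I_d -> L) :
    (forall c, pol_val f x (h c)) -> (forall c, h c = 0 -> c = 0) ->
    free_mod f [set 0] T ->
  exists s (y : 'I_s -> L), free_mod h [set 0] y /\ (d <= n + s)%N.
Proof.
move=> hx h0 Tfree.
suff H b s (y : 'I_s -> L) : (d - (n + s) <= b)%N -> free_mod h [set 0] y ->
    exists s (y : 'I_s -> L), free_mod h [set 0] y /\ (d <= n + s)%N.
  apply: (H d 0%N (fun=> 0)); first exact: leq_subr.
  by apply: free_mod_nil => c; apply: h0.
elim: b s y => [|b IH] s y db yfree.
  by exists s, y; split=> //; rewrite -subn_eq0 -leqn0.
have [dns|nsd] := leqP d (n + s); first by exists s, y.
have [z zfree] := free_extend hx yfree Tfree nsd.
by apply: IH zfree; lia.
Qed.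

End FieldExtension.

(** * Spanning the residue field *)

Lemma root_const_neq0 (L : fieldType) (V : set L) (F : {poly L}) z :
    F != 0 -> (forall i, V F`_i) -> root F z -> z != 0 ->
  exists G : {poly L}, [/\ G`_0 != 0, forall i, V G`_i & root G z].
Proof.
move=> + + + z0; elim/poly_ind: F => [|F c IH]; first by rewrite eqxx.
have [->|c0] := eqVneq c 0.
  rewrite addr0 => F0 FV; rewrite rootM rootX (negbTE z0) orbF; apply: IH.
    by apply: contra_neq F0 => ->; rewrite mul0r.
  by move=> i; have := FV i.+1; rewrite coefMX.
move=> _ FV Fz; exists (F * 'X + c%:P); split=> //.
by rewrite coefD coefMX coefC /= add0r.
Qed.

Section ResidueSpan.
Variables (k L : fieldType) (A : comNzRingType) (P : idomainType).
Variables (j : {rmorphism k -> A}) (rho : {rmorphism A -> L}) (h : {rmorphism P -> A}).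
Hypothesis A_eft : ess_finite_type j.
Hypothesis j_h : forall c, exists q, h q = j c.

Let V : set L := [set z | exists q, z = rho (h q)].

Hypothesis rho_alg : forall a,
  exists F : {poly L}, [/\ F != 0, forall i, V F`_i & root F (rho a)].

(* The residue of A is the fraction field of that of a finitely generated     *)
(* algebra: monomials of bounded degree span the latter, and an inverse 1/s   *)
(* is a polynomial in s by algebraicity.                                      *)
Lemma residue_span : exists (I : finType) (e : I -> A), forall a,
  exists q (c : I -> P), q != 0 /\ rho (h q * a) = rho (\sum_i h (c i) * e i).
Proof.
have V0 : V 0 by exists 0; rewrite !rmorph0.
have V1 : V 1 by exists 1; rewrite !rmorph1.
have VN z : V z -> V (- z) by move=> [q ->]; exists (- q); rewrite !rmorphN.
have VD z w : V z -> V w -> V (z + w).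
  by move=> [q ->] [r ->]; exists (q + r); rewrite !rmorphD.
have VM z w : V z -> V w -> V (z * w).
  by move=> [q ->] [r ->]; exists (q * r); rewrite !rmorphM.
have VX z d : V z -> V (z ^+ d) by move=> [q ->]; exists (q ^+ d); rewrite !rmorphXn.
case: A_eft => B [jB [S [phi [[n [x xgen]] _ [Sunit Sfrac _] phij]]]].
pose y i := rho (phi (x i)).
have [N [Q [p [QV pV _ Qy]]]] := lead_relation (y := y) V0 VN (fun i => rho_alg (phi (x i))).
pose I : finType := {ffun 'I_n -> 'I_N.+1}.
pose T : set L := [set z | exists q (c : I -> L),
  [/\ q != 0, V q, forall g, V (c g) & q * z = \sum_g c g * mon y g]].
have TD z w : T z -> T w -> T (z + w).
  move=> [q [c [q0 Vq Vc qz]]] [r [d [r0 Vr Vd rw]]].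
  exists (q * r), (fun g => r * c g + q * d g); split.
  - exact: mulf_neq0.
  - exact: VM.
  - by move=> g; apply: VD; apply: VM.
  rewrite mulrDr mulrAC qz -mulrA rw mulr_suml mulr_sumr -big_split.
  by apply: eq_bigr => g _; rewrite /= mulrDl mulrA; congr (_ + _); rewrite mulrAC [r * _]mulrC.
have TZ r z : V r -> T z -> T (r * z).
  move=> Vr [q [c [q0 Vq Vc qz]]]; exists q, (fun g => r * c g); split=> //.
    by move=> g; apply: VM.
  by rewrite mulrCA qz mulr_sumr; apply: eq_bigr => g _; rewrite mulrA.
have TV r z : V r -> r != 0 -> T (r * z) -> T z.
  move=> Vr r0 [q [c [q0 Vq Vc qz]]]; exists (q * r), c; split=> //.
  - exact: mulf_neq0.
  - exact: VM.
  - by rewrite -mulrA.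
have TB b : T (rho (phi b)).
  have [P0 ->] := xgen b; pose M := msize P0.
  have /choice[a aP] := fun e : {ffun 'I_n -> 'I_M} =>
    reduce_monomial (W := fun=> V) (C := 0) (fun=> V0) V1 (fun=> VD) (fun _ _ => VM)
      e (fun i => (QV i).2) pV Qy.
  exists ((\prod_i Q i) ^+ M), (fun g => \sum_e rho (j P0@_(mnm_of e)) * a e g); split.
  - by apply: expf_neq0; apply/prodf_neq0 => i _; have [] := QV i.
  - by apply: VX; apply: (big_ind V) => // i _; have [] := QV i.
  - move=> g; apply: (big_ind V) => // e _; apply: VM; last by have [] := aP e.
    by have [q <-] := j_h P0@_(mnm_of e); exists q.
  rewrite (mmap_boxE jB x (leqnn _)) !rmorph_sum mulr_sumr.
  transitivity (\sum_(e : {ffun 'I_n -> 'I_M}) \sum_g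
      rho (j P0@_(mnm_of e)) * (a e g * mon y g)).
    apply: eq_bigr => e _; rewrite -mulr_sumr -(aP e).2 /= !rmorphM phij /= mulrCA.
    congr (_ * (_ * _)); rewrite /mon !rmorph_prod; apply: eq_bigr => i _.
    by rewrite /= !rmorphXn.
  rewrite exchange_big; apply: eq_bigr => g _; rewrite mulr_suml.
  by apply: eq_bigr => e _; rewrite mulrA.
have TA a : T (rho a).
  have [b [s [Ss as_b]]] := Sfrac a.
  pose z := rho (phi s).
  have z0 : z != 0.
    have [u su] := Sunit _ Ss; apply/eqP => z0.
    have : rho (phi s * u) = 0 by rewrite rmorphM -/z z0 mul0r.
    by rewrite su rmorph1 => /eqP; rewrite oner_eq0.
  have [F [F0 FV Fz]] := rho_alg (phi s).
  have {F F0 FV Fz}[G [G0 GV Gz]] := root_const_neq0 F0 FV Fz z0.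
  apply: (TV G`_0) => //.
  have az : rho a * z = rho (phi b) by rewrite -rmorphM as_b.
  have sG : (0 < size G)%N by case: (size G) (@nth_default _ 0 G 0) G0 => // -> //; rewrite eqxx.
  have : G`_0 * rho a = \sum_(i < (size G).-1) (- G`_i.+1) * rho (phi (b * s ^+ i)).
    apply: (mulIf z0); have := rootP Gz; rewrite horner_coef -(prednK sG) big_ord_recl.
    rewrite expr0 mulr1 => /eqP; rewrite addr_eq0 => /eqP ->.
    rewrite -mulrA az mulNr mulr_suml -sumrN mulr_suml; apply: eq_bigr => i _.
    rewrite !mulNr -!mulrA; congr (- (_ * _)).
    by rewrite !rmorphM !rmorphXn /= -mulrA -exprSr mulrC.
  move=> ->; apply: (big_ind T) => // [|i _]; last by apply: TZ => //; apply: VN.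
  exists 1, (fun=> 0); split=> //; rewrite ?oner_eq0 // mulr0 big1 // => g _.
  by rewrite mul0r.
exists I, (fun g => mon (fun i => phi (x i)) g) => a.
have [q [c [q0 [q' q'E] /choice[c' cE] qa]]] := TA a.
exists q', c'; split; first by apply: contra_neq q0 => q'0; rewrite q'E q'0 !rmorph0.
rewrite rmorphM -q'E qa rmorph_sum; apply: eq_bigr => g _.
rewrite /= rmorphM cE; congr (_ * _); rewrite rmorph_prod.
by apply: eq_bigr => i _; rewrite /= rmorphXn.
Qed.

End ResidueSpan.

(** * Values of monomials *)

Section ValuationBounds.
Variables (k K : fieldType) (f : {rmorphism k -> K}) (R : realType) (v : valuation f R).

Definition vgt (l : R) : set K := [set x | x = 0 \/ l < v x].

Lemma vgt_le l l' : l <= l' -> vgt l' `<=` vgt l.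
Proof. by move=> ll' x [->|l'x]; [left | right; apply: le_lt_trans l'x]. Qed.

Lemma vgtD l x y : vgt l x -> vgt l y -> vgt l (x + y).
Proof.
case=> [->|lx]; first by rewrite add0r.
case=> [->|ly]; first by rewrite addr0; right.
have [->|x0] := eqVneq x 0; first by rewrite add0r; right.
have [->|y0] := eqVneq y 0; first by rewrite addr0; right.
have [->|xy0] := eqVneq (x + y) 0; first by left.
by right; apply: lt_le_trans (val_add v x0 y0 xy0); rewrite lt_min lx.
Qed.

Lemma vgtN l x : vgt l x -> vgt l (- x).
Proof. by case=> [->|lx]; [left; rewrite oppr0 | right; rewrite valN]. Qed.

Lemma vgt_sum l (I : finType) (Q : pred I) (F : I -> K) :
  (forall i, Q i -> vgt l (F i)) -> vgt l (\sum_(i | Q i) F i).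
Proof. by move=> FP; apply: (big_ind (vgt l)) => //; [left | exact: vgtD]. Qed.

Lemma vgtM l a x : a \in val_ge0 v -> vgt l x -> vgt l (a * x).
Proof.
have [-> _|a0] := eqVneq a 0; first by rewrite mul0r; left.
rewrite /val_ge0 /in_mem /= (negbTE a0) /= => va.
have [->|x0] := eqVneq x 0; first by rewrite mulr0; left.
by case=> [->|lx]; [rewrite mulr0; left | right; rewrite val_mul // ltr_wpDl].
Qed.

Lemma vgt_mul l a x : a != 0 -> vgt l (a * x) -> vgt (l - v a) x.
Proof.
move=> a0; have [->|x0] := eqVneq x 0; first by left.
case=> [/eqP|]; first by rewrite mulf_eq0 (negbTE a0) (negbTE x0).
by rewrite val_mul // => lax; right; rewrite ltrBlDl.
Qed.

Lemma vgt_irr x : x != 0 -> ~ vgt (v x) x.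
Proof. by move=> x0 [/eqP|]; rewrite ?(negbTE x0) ?ltxx. Qed.

Lemma val_exp x n : x != 0 -> v (x ^+ n) = v x *+ n.
Proof.
move=> x0; elim: n => [|n IH]; first by rewrite expr0 mulr0n Defs.val1.
by rewrite exprS mulrS val_mul ?expf_neq0 // IH.
Qed.

Lemma val_prod (I : finType) (F : I -> K) :
  (forall i, F i != 0) -> \prod_i F i != 0 /\ v (\prod_i F i) = \sum_i v (F i).
Proof.
move=> F0; apply: (big_rec2 (fun z s => z != 0 /\ v z = s)) => [|i z s _ [z0 vz]].
  by rewrite oner_eq0 Defs.val1.
by rewrite mulf_neq0 // val_mul // vz.
Qed.

Lemma sum_distinct_values (I : finType) (z : I -> K) l :
    (forall i i', z i != 0 -> z i' != 0 -> v (z i) = v (z i') -> i = i') ->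
    (forall i, z i != 0 -> v (z i) <= l) -> (exists i, z i != 0) ->
  ~ vgt l (\sum_i z i).
Proof.
move=> zinj zl [i0 zi0] zsum.
case: (arg_minP (P := fun i => z i != 0) (fun i => v (z i)) zi0) => i1 zi1 imin.
have rest : vgt (v (z i1)) (\sum_(i | i != i1) z i).
  apply: vgt_sum => i ii1; have [->|zi] := eqVneq (z i) 0; [by left|right].
  rewrite lt_neqAle imin // andbT; apply: contra_neq ii1 => vE.
  exact: (zinj i i1).
apply: (vgt_irr zi1); have := vgt_le (zl _ zi1) zsum; rewrite (bigD1 i1) //= => s1.
by have := vgtD s1 (vgtN rest); rewrite addrK.
Qed.

Section Independent.
Variables (P : comNzRingType) (h : {rmorphism P -> K}).
Variables (r d : nat) (x : 'I_r -> K) (y : 'I_d -> K).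
Hypothesis x0 : forall i, x i != 0.
Hypothesis x_indep : forall a b : 'I_r -> nat,
  \sum_i v (x i) *+ a i = \sum_i v (x i) *+ b i -> a =1 b.
Hypothesis y_indep : forall B (c : {ffun 'I_d -> 'I_B} -> P), (exists e, c e != 0) ->
  \sum_e h (c e) * mon y e != 0 /\ v (\sum_e h (c e) * mon y e) = 0.

Lemma monomials_not_vgt T (u : {ffun 'I_r -> 'I_T} * {ffun 'I_d -> 'I_T} -> P) :
    (exists i, u i != 0) ->
  ~ vgt ((\sum_i `|v (x i)|) *+ T) (\sum_i h (u i) * (mon x i.1 * mon y i.2)).
Proof.
move=> [[a0 b0] u0].
pose s a := \sum_b h (u (a, b)) * mon y b; pose z a := mon x a * s a.
have -> : \sum_i h (u i) * (mon x i.1 * mon y i.2) = \sum_a z a.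
  under [RHS]eq_bigr => a _ do rewrite /z /s mulr_sumr.
  by rewrite pair_big /=; apply: eq_bigr => -[a b] _ /=; rewrite mulrCA.
have [m0 vm] : (forall a : {ffun 'I_r -> 'I_T}, mon x a != 0) /\
    (forall a : {ffun 'I_r -> 'I_T}, v (mon x a) = \sum_i v (x i) *+ a i).
  have H (a : {ffun 'I_r -> 'I_T}) := @val_prod _ (fun i => x i ^+ a i) (fun i => expf_neq0 (a i) (x0 i)).
  split=> a; first by have [] := H a.
  by rewrite /mon (H a).2; apply: eq_bigr => i _; rewrite val_exp.
have s0 a b : u (a, b) != 0 -> s a != 0 /\ v (s a) = 0.
  by move=> uab; apply: (@y_indep _ (fun b => u (a, b))); exists b.
have sz a : z a != 0 -> s a != 0 /\ v (s a) = 0.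
  move=> za; have [[b uab]|ua0] := pselect (exists b, u (a, b) != 0); first exact: s0 uab.
  case/eqP: za; rewrite /z /s big1 ?mulr0 // => b _.
  have [->|uab] := eqVneq (u (a, b)) 0; first by rewrite rmorph0 mul0r.
  by case: ua0; exists b.
have vz a : z a != 0 -> v (z a) = \sum_i v (x i) *+ a i.
  by move=> /sz[sa0 sa]; rewrite val_mul // sa addr0 vm.
apply: sum_distinct_values.
- move=> a b za zb; rewrite !vz // => /(@x_indep (fun i => a i) (fun i => b i)) ab.
  by apply/ffunP => i; apply: val_inj; apply: ab.
- move=> a za; rewrite vz // -sumrMnl; apply: ler_sum => i _.
  apply: (@le_trans _ _ (`|v (x i)| *+ a i)); first by rewrite lerMn2r ler_norm orbT.
  by apply: ler_wpMn2l => //; apply: ltnW.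
- by exists a0; rewrite mulf_neq0 //; have [] := s0 _ _ u0.
Qed.

End Independent.
End ValuationBounds.

(** * Colength of ideals containing an element of given order *)

Lemma leq_sum_ord D (F : 'I_D -> nat) i : (F i <= \sum_j F j)%N.
Proof. by rewrite (bigD1 i) //= leq_addr. Qed.

Lemma card_coordinate_lt D L (i : 'I_D) a :
  (#|[pred b : {ffun 'I_D -> 'I_L} | (b i < a)%N]| <= a * L ^ D.-1)%N.
Proof.
pose F j : pred 'I_L := if j == i then [pred x : 'I_L | (x < a)%N] else predT.
rewrite (_ : #|_| = #|family F|); last first.
  apply: eq_card => b; rewrite !inE; apply/idP/familyP => [bi j|/(_ i)].
    by rewrite /F; case: eqP => [->|//]; rewrite inE.
  by rewrite /F eqxx inE.
rewrite card_family foldrE big_map big_enum /= (bigD1 i) //= leq_mul //.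
  rewrite /F eqxx -sum1_card.
  rewrite (eq_bigl (fun x : 'I_L => (x < a)%N)) // -(big_mkord (fun x => (x < a)%N) (fun=> 1%N)).
  apply: (@leq_trans (\sum_(0 <= x < a) 1)%N); last by rewrite sum_nat_const_nat subn0 muln1.
  rewrite [leqLHS]sum1_count [leqRHS]sum1_size size_iota subn0.
  rewrite -size_filter -[leqRHS](size_iota 0 a); apply: uniq_leq_size.
    by rewrite filter_uniq // iota_uniq.
  by move=> x; rewrite mem_filter mem_iota leq0n add0n => /andP[].
rewrite (eq_bigr (fun=> L)) => [|j /negbTE ji]; last by rewrite /F ji card_ord.
by rewrite prod_nat_const -[X in (L ^ X <= _)%N]/(#|predC1 i|) cardC1 card_ord.
Qed.

Lemma card_not_divisible D L (a : 'X_{1..D}) :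
  (#|[pred b : {ffun 'I_D -> 'I_L} | ~~ (a <= mnm_of b)%MM]| <= mdeg a * L ^ D.-1)%N.
Proof.
rewrite mdegE big_distrl /=.
apply: (@leq_trans (\sum_i #|[pred b : {ffun 'I_D -> 'I_L} | (b i < a i)%N]|)); last first.
  by apply: leq_sum => i _; apply: card_coordinate_lt.
under eq_bigr => i _ do rewrite -sum1_card big_mkcond.
rewrite exchange_big -sum1_card big_mkcond; apply: leq_sum => b _ /=.
rewrite inE; case: ifP => // /mnm_lepP/existsNP[i].
rewrite mnmE => /negP; rewrite -ltnNge => bi.
apply: leq_trans (leq_sum_ord _ i); by rewrite inE bi.
Qed.

Section Span.
Variables (P : idomainType) (A : comNzRingType) (h : {rmorphism P -> A}).
Variable I0 : set A.
Hypothesis I0_ideal : is_ideal I0.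

(* Elements congruent modulo I0 to a combination of s, up to a denominator in P. *)
Definition span_mod (J : finType) (s : J -> A) : set A :=
  [set a | exists q (c : J -> P), q != 0 /\ I0 (h q * a - \sum_i h (c i) * s i)].

Variables (J : finType) (s : J -> A).

Lemma I0D x y : I0 x -> I0 y -> I0 (x + y).
Proof. by case: I0_ideal => _ + _; apply. Qed.
Lemma I0M a x : I0 x -> I0 (a * x).
Proof. by case: I0_ideal => _ _; apply. Qed.

Lemma span_ideal a : I0 a -> span_mod s a.
Proof.
move=> aI; exists 1, (fun=> 0); rewrite oner_neq0; split=> //.
by rewrite big1 ?subr0 => [|i _]; [apply: I0M | rewrite rmorph0 mul0r].
Qed.

Lemma spanD a b : span_mod s a -> span_mod s b -> span_mod s (a + b).
Proof.
move=> [q [c [q0 qa]]] [r [d [r0 rb]]].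
exists (q * r), (fun i => r * c i + q * d i); rewrite mulf_neq0 //; split=> //.
have := I0D (I0M (h r) qa) (I0M (h q) rb); congr I0.
under [in RHS]eq_bigr => i _ do rewrite rmorphD !rmorphM mulrDl -!mulrA.
rewrite big_split /= -!mulr_sumr rmorphM !mulrBr mulrDr opprD addrACA.
by congr (_ + _ + _); rewrite mulrA // [h r * h q]mulrC.
Qed.

Lemma span_gen i : span_mod s (s i).
Proof.
exists 1, (fun j => (j == i)%:R); rewrite oner_neq0; split=> //.
rewrite (bigD1 i) //= big1 ?addr0 => [|j /negbTE ->]; last by rewrite rmorph0 mul0r.
by rewrite eqxx subrr; case: I0_ideal.
Qed.

Lemma spanZ q a : span_mod s a -> span_mod s (h q * a).
Proof.
move=> [r [c [r0 ra]]]; exists r, (fun i => q * c i); split=> //.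
have := I0M (h q) ra; congr I0; rewrite mulrBr mulrCA mulr_sumr; congr (_ - _).
by apply: eq_bigr => i _; rewrite rmorphM mulrA.
Qed.

Lemma span_div q a : q != 0 -> span_mod s (h q * a) -> span_mod s a.
Proof.
move=> q0 [r [c [r0 ra]]]; exists (r * q), c; rewrite mulf_neq0 //; split=> //.
by rewrite rmorphM -mulrA.
Qed.

Lemma span_sum (T : Type) (r : seq T) (Q : pred T) (F : T -> A) :
  (forall i, Q i -> span_mod s (F i)) -> span_mod s (\sum_(i <- r | Q i) F i).
Proof.
move=> FS; apply: (big_ind (span_mod s)) => //; last exact: spanD.
by apply: span_ideal; case: I0_ideal.
Qed.

Lemma span_sum_seq (T : eqType) (r : seq T) (Q : pred T) (F : T -> A) :
    (forall i, i \in r -> Q i -> span_mod s (F i)) ->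
  span_mod s (\sum_(i <- r | Q i) F i).
Proof.
by move=> FS; rewrite big_seq_cond; apply: span_sum => i /andP[ri Qi]; apply: FS.
Qed.

Hypothesis J_span : forall a, span_mod s a.

Lemma span_dependent (T : finType) (V : T -> A) : (#|J| < #|T|)%N ->
  exists u : T -> P, (exists i, u i != 0) /\ I0 (\sum_i h (u i) * V i).
Proof.
move=> JT.
have /choice[q /choice[c qcP]] := fun i => J_span (V i).
have [u [[i ui] uc]] := idomain_dependent c JT.
exists (fun i => u i * q i); split.
  by exists i; rewrite mulf_neq0 //; have [] := qcP i.
have -> : \sum_i h (u i * q i) * V i =
    \sum_i h (u i) * (h (q i) * V i - \sum_l h (c i l) * s l).
  under [RHS]eq_bigr => l _ do rewrite mulrBr mulr_sumr.
  rewrite sumrB exchange_big [X in _ - X]big1 ?subr0 => [|l _].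
    by apply: eq_bigr => l _; rewrite rmorphM mulrA.
  under eq_bigr => l' _ do rewrite mulrA -rmorphM.
  by rewrite -mulr_suml -rmorph_sum /= uc rmorph0 mul0r.
by apply: (big_ind I0) => [||l _]; [case: I0_ideal | exact: I0D | apply/I0M; have [] := qcP l].
Qed.

End Span.

Section MonomialSpan.
Variables (P : idomainType) (A : comNzRingType) (h : {rmorphism P -> A}).
Variables (m I0 : set A) (D : nat) (g : 'I_D -> A) (F : finType) (e : F -> A).
Hypothesis m_ideal : is_ideal m.
Hypothesis m_unit : forall a, ~ m a -> exists u, a * u = 1.
Hypothesis m_gen : forall a, m a -> exists b : 'I_D -> A, a = \sum_i b i * g i.
Hypothesis e_span : forall a, span_mod h m e a.
Hypothesis I0_ideal : is_ideal I0.
Variables (n L : nat) (U : {mpoly A[D]}).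
Hypothesis U_homog : U \is n.-homog.
Hypothesis U_unit : exists b, ~ m U@_b.
Hypothesis U_I0 : I0 U.@[g].
Hypothesis g_I0 : forall b, (L <= mdeg b)%N -> I0 (mmap1 g b).

Lemma mmap1D b c : mmap1 g (b + c)%MM = mmap1 g b * mmap1 g c.
Proof. by apply: commr_mmap1_M => i x; apply: mulrC. Qed.

Lemma exists_min_unit_coef : exists a,
  ~ m U@_a /\ forall b, b \in msupp U -> b != a -> ~ m U@_b -> (a < b)%O.
Proof.
have m0 : m 0 by case: m_ideal.
pose r := sort <=%O [seq b <- msupp U | ~~ `[< m U@_b >]].
have inr b : b \in msupp U -> ~ m U@_b -> b \in r.
  by move=> bU mb; rewrite mem_sort mem_filter bU andbT; apply/negP => /asboolP.
have : sorted <=%O r by apply: sort_sorted; apply: le_total.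
have rm b : b \in r -> ~ m U@_b.
  by rewrite mem_sort mem_filter => /andP[/negP mb _] ?; apply/mb/asboolP.
case: U_unit => b mb; have : b \in r.
  apply: inr => //; rewrite mcoeff_msupp; apply: contra_notN mb => /eqP ->.
  exact: m0.
case: r inr rm => // a r inr rm _ /le_path_min/allP amin.
exists a; split; first by apply: rm; rewrite mem_head.
move=> c cU ca mc; have := inr _ cU mc; rewrite inE (negbTE ca) /= => /amin.
by rewrite lt_def ca.
Qed.

(* Let a be the deglex-least exponent of U with a unit coefficient.  Multiples *)
(* of g^a can be traded, modulo I0, for deglex-larger monomials, and residues  *)
(* reduce the coefficients of the others to the span of e.                     *)
Lemma monomial_span : exists (J : finType) (s : J -> A),
  (forall a, span_mod h I0 s a) /\ (#|J| <= #|F| * (n * L ^ D.-1))%N.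
Proof.
have [a [ma amin]] := exists_min_unit_coef.
have [w aw] := m_unit ma.
have aU : a \in msupp U.
  by rewrite mcoeff_msupp; apply: contra_notN ma => /eqP ->; case: m_ideal.
have deg_a : mdeg a = n by apply: (dhomog_mf U_homog).
pose N : finType := {b : {ffun 'I_D -> 'I_L} | ~~ (a <= mnm_of b)%MM}.
pose s (fb : F * N) := e fb.1 * mmap1 g (mnm_of (val fb.2)).
exists (F * N)%type, s; split; last first.
  by rewrite card_prod leq_mul2l card_sig -deg_a card_not_divisible orbT.
suff H M : forall b, (#|[pred c : 'X_{1..D < L} | (b < (c : 'X_{1..D}))%O]| < M)%N ->
    forall x, span_mod h I0 s (mmap1 g b * x).
  by move=> x; have := H _ 0%MM (ltnSn _) x; rewrite mmap11 mul1r.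
have big_deg b x : (L <= mdeg b)%N -> span_mod h I0 s (mmap1 g b * x).
  by move=> /g_I0 bI; apply: span_ideal => //; rewrite mulrC; apply: I0M.
elim: M => [|M IH] b // bM x.
have [Lb|bL] := leqP L (mdeg b); first exact: big_deg.
have up c y : (b < c)%O -> span_mod h I0 s (mmap1 g c * y).
  move=> bc; have [/big_deg//|cL] := leqP L (mdeg c).
  apply: IH; apply: leq_trans (ltnSE bM); apply: proper_card.
  apply/properP; split; first by apply/fintype.subsetP => d; rewrite !inE; apply: lt_trans.
  by exists (BMultinom cL); rewrite !inE ?ltxx.
have upm c y z : (mdeg b <= mdeg c)%N -> m z -> span_mod h I0 s (mmap1 g c * (z * y)).
  move=> bc /m_gen[d ->]; rewrite mulr_suml mulr_sumr; apply: span_sum => // i _.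
  have -> : mmap1 g c * (d i * g i * y) = mmap1 g (c + U_(i))%MM * (d i * y).
    by rewrite mmap1D mmap1U -!mulrA [d i * _]mulrCA.
  by apply: up; apply: lt_mdeg_ltmc; rewrite mdegD mdeg1 addn1.
have [ab|ab] := boolP (a <= b)%MM.
  have zE : mmap1 g a = w * U.@[g] -
      \sum_(c <- msupp U | c != a) w * (U@_c * mmap1 g c).
    rewrite mevalE (bigD1_seq a) ?msupp_uniq //= mulrDr mulr_sumr addrK mulrA.
    by rewrite [w * _]mulrC aw mul1r.
  rewrite -(submK ab) mmap1D zE mulrBr mulrBl.
  apply: spanD => //.
    by apply: span_ideal => //; rewrite mulrAC mulrA; apply: I0M.
  rewrite mulr_sumr mulr_suml -sumrN; apply: span_sum_seq => // c cU ca.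
  have -> : - (mmap1 g (b - a) * (w * (U@_c * mmap1 g c)) * x) =
      mmap1 g (b - a + c)%MM * (U@_c * (- (w * x))).
    by rewrite mmap1D; ring.
  have [mc|mc] := pselect (m U@_c).
    apply: upm => //; rewrite -{1}(submK ab) !mdegD leq_add2l deg_a.
    by rewrite (dhomog_mf U_homog).
  by apply: up; rewrite -{1}(submK ab) ltmc_add2r; apply: amin.
have bE : exists b' : {ffun 'I_D -> 'I_L}, b = mnm_of b'.
  have bi i : (b i < L)%N.
    by apply: leq_ltn_trans bL; rewrite mdegE; apply: (leq_sum_ord (fun i => b i)).
  by exists [ffun i => Ordinal (bi i)]; apply/mnmP => i; rewrite mnmE ffunE.
have [b' bb'] := bE.
have ab' : ~~ (a <= mnm_of b')%MM by rewrite -bb'.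
have [q [c [q0 qx]]] := e_span x.
apply: (span_div q0).
have -> : h q * (mmap1 g b * x) = mmap1 g b * ((h q * x - \sum_i h (c i) * e i) * 1) +
    \sum_i h (c i) * s (i, exist _ b' ab').
  have -> : \sum_i h (c i) * s (i, exist _ b' ab') = mmap1 g b * \sum_i h (c i) * e i.
    by rewrite bb' mulr_sumr; apply: eq_bigr => i _; rewrite /s /=; ring.
  by ring.
apply: spanD => //; first exact: upm.
by apply: span_sum => // i _; apply: spanZ => //; apply: span_gen.
Qed.

End MonomialSpan.

(** * Values and orders *)

Section OrderBounds.
Variables (k K : fieldType) (A : comNzRingType) (f : {rmorphism k -> K}) (R : realType).
Variables (iota : {rmorphism A -> K}) (v : valuation f R) (m : set A).
Hypothesis v_centered : centered v iota m.
Variables (D : nat) (g : 'I_D -> A).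
Hypothesis g_m : forall i, m (g i).

Definition vge (l : R) : set K := [set x | x = 0 \/ l <= v x].

Lemma vgeD l x y : vge l x -> vge l y -> vge l (x + y).
Proof.
case=> [->|lx]; first by rewrite add0r.
case=> [->|ly]; first by rewrite addr0; right.
have [->|x0] := eqVneq x 0; first by rewrite add0r; right.
have [->|y0] := eqVneq y 0; first by rewrite addr0; right.
have [->|xy0] := eqVneq (x + y) 0; first by left.
by right; apply: le_trans (val_add v x0 y0 xy0); rewrite le_min lx.
Qed.

Lemma vgeM l l' x y : vge l x -> vge l' y -> vge (l + l') (x * y).
Proof.
have [->|x0] := eqVneq x 0; first by rewrite mul0r; left.
have [->|y0] := eqVneq y 0; first by rewrite mulr0; left.
case=> [/eqP|lx]; first by rewrite (negbTE x0).
case=> [/eqP|ly]; first by rewrite (negbTE y0).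
by right; rewrite val_mul // lerD.
Qed.

Lemma vge_center a : vge 0 (iota a).
Proof.
case: v_centered => /(_ a); rewrite /val_ge0 /in_mem /= => /orP[/eqP|]; by [left|right].
Qed.

Lemma val_center_unit a : ~ m a -> iota a != 0 /\ v (iota a) = 0.
Proof.
case: v_centered => va mE; rewrite mE /= /val_gt0 /in_mem /= => /negP.
rewrite negb_or -leNgt => /andP[a0 va0]; split=> //; apply/eqP; rewrite eq_le va0.
by have := va a; rewrite /val_ge0 /in_mem /= (negbTE a0).
Qed.

Lemma gen_value_bound : exists2 c : R, 0 < c & forall i, vge c (iota (g i)).
Proof.
have gi i : iota (g i) = 0 \/ 0 < v (iota (g i)).
  have := g_m i; case: v_centered => _ -> /=.
  by rewrite /val_gt0 /in_mem /= => /orP[/eqP|]; [left|right].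
exists (\big[Order.min/1]_(i < D | iota (g i) != 0) v (iota (g i))).
  by apply: lt_bigmin => // i; case: (gi i) => [->|//]; rewrite eqxx.
move=> i; have [->|i0] := eqVneq (iota (g i)) 0; [by left|right].
exact: bigmin_le_cond.
Qed.

Lemma vge_monomial c b : (forall i, vge c (iota (g i))) ->
  vge (c *+ mdeg b) (iota (mmap1 g b)).
Proof.
move=> cg; rewrite /mmap1 mdegE rmorph_prod.
apply: (big_rec2 (fun x s => vge (c *+ s) x)) => [|i x s _ IH].
  by right; rewrite Defs.val1.
rewrite mulrnDr; apply: vgeM => //; rewrite rmorphXn /=.
elim: (b i) => [|d IHd]; first by right; rewrite expr0 Defs.val1.
by rewrite exprS mulrS; apply: vgeM.
Qed.

Lemma vge_homog c n (U : {mpoly A[D]}) : (forall i, vge c (iota (g i))) ->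
  U \is n.-homog -> vge (c *+ n) (iota U.@[g]).
Proof.
move=> cg Uh; rewrite mevalE rmorph_sum big_seq_cond.
apply: (big_ind (vge (c *+ n))); [by left | exact: vgeD|].
move=> b /andP[bU _] /=; rewrite rmorphM -[_ *+ n]add0r -(dhomog_mf Uh bU).
by apply: vgeM; [exact: vge_center | exact: vge_monomial].
Qed.

Hypothesis m_gen : forall a, m a -> exists b : 'I_D -> A, a = \sum_i b i * g i.

Lemma homog_coef_unit n (U : {mpoly A[D]}) : U \is n.-homog ->
    (forall V : {mpoly A[D]}, V \is n.+1.-homog -> U.@[g] <> V.@[g]) ->
  exists b, ~ m U@_b.
Proof.
move=> Uh; apply: contraPP => /forallNP Um; apply/existsNP.
have /choice[a aP] : forall b, exists a : 'I_D -> A, U@_b = \sum_i a i * g i.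
  by move=> b; apply: m_gen; apply: contrapT (Um b).
exists (\sum_(b <- msupp U) (\sum_i a b i *: 'X_i) * 'X_[b]).
apply/not_implyP; split.
  rewrite big_seq_cond; apply: rpred_sum => b /andP[bU _]; rewrite -add1n.
  apply: dhomogM; last by rewrite dhomogX (dhomog_mf Uh bU) eqxx.
  by apply: rpred_sum => i _; apply: dhomogZ; rewrite dhomogX /= mdeg1.
apply; rewrite {1}mevalE raddf_sum; apply: eq_bigr => b _ /=.
rewrite mevalM mevalX aP raddf_sum; congr (_ * _); apply: eq_bigr => i _ /=.
by rewrite mevalZ mevalXU.
Qed.

End OrderBounds.

Section CommonDenominator.
Variables (A : comNzRingType) (K : fieldType) (iota : {rmorphism A -> K}).
Hypothesis K_frac : is_fraction_field iota.

Lemma common_denominator (I : finType) (x : I -> K) :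
  exists b (a : I -> A), iota b != 0 /\ forall i, iota (a i) = x i * iota b.
Proof.
case: K_frac => inj frac.
have /choice[ab abP] : forall i, exists ab : A * A,
    iota ab.2 != 0 /\ x i = iota ab.1 / iota ab.2.
  move=> i; have [a [b [b0 xE]]] := frac (x i); exists (a, b); split=> //=.
  by apply: contra_neq b0 => b0; apply: inj; rewrite b0 rmorph0.
exists (\prod_i (ab i).2), (fun i => (ab i).1 * \prod_(l | l != i) (ab l).2); split.
  by rewrite rmorph_prod; apply/prodf_neq0 => i _; have [] := abP i.
move=> i; have [b0 ->] := abP i; rewrite [in RHS](bigD1 i) //= !rmorphM /=.
by rewrite mulrA divfK.
Qed.

End CommonDenominator.

Section OrderUpperBound.
Variables (k K : fieldType) (A : comNzRingType) (f : {rmorphism k -> K}) (R : realType).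
Variables (iota : {rmorphism A -> K}) (v : valuation f R) (m : set A).
Hypothesis v_centered : centered v iota m.
Hypothesis K_frac : is_fraction_field iota.
Hypothesis m_ideal : is_ideal m.
Hypothesis m_unit : forall a, ~ m a -> exists u, a * u = 1.
Variables (D : nat) (g : 'I_D -> A).
Hypothesis g_m : forall i, m (g i).
Hypothesis m_gen : forall a, m a -> exists b : 'I_D -> A, a = \sum_i b i * g i.
Variables (P : idomainType) (h : {rmorphism P -> A}) (F : finType) (e : F -> A).
Hypothesis e_span : forall a, span_mod h m e a.
Variables (r d : nat) (x : 'I_r -> K) (y : 'I_d -> K).
Hypothesis x0 : forall i, x i != 0.
Hypothesis x_indep : forall a b : 'I_r -> nat,
  \sum_i v (x i) *+ a i = \sum_i v (x i) *+ b i -> a =1 b.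
Hypothesis y_indep : forall B (c : {ffun 'I_d -> 'I_B} -> P), (exists e, c e != 0) ->
  \sum_e (iota \o h) (c e) * mon y e != 0 /\
  v (\sum_e (iota \o h) (c e) * mon y e) = 0.
Hypothesis D_le : (D <= r + d)%N.

Lemma vgt_center_ideal l : is_ideal [set a | vgt v l (iota a)].
Proof.
split=> [|a b|a b] /=; first by rewrite rmorph0; left.
  by rewrite rmorphD; apply: vgtD.
by rewrite rmorphM; apply: vgtM; case: v_centered.
Qed.

Lemma low_value_family : exists c : R, 0 < c /\ forall T,
  exists V : {ffun 'I_r -> 'I_T} * {ffun 'I_d -> 'I_T} -> A,
    forall u, (exists i, u i != 0) -> ~ vgt v (c *+ T) (iota (\sum_i h (u i) * V i)).
Proof.
have [b [a [b0 aE]]] := common_denominator K_frac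
  (fun i : 'I_r + 'I_d => match i with inl i => x i | inr i => y i end).
have vb : 0 <= v (iota b).
  by have [/eqP|//] := vge_center v_centered b; rewrite (negbTE b0).
pose c := \sum_i `|v (x i)| + v (iota b) *+ (r + d) + 1.
have c0 : 0 < c.
  by rewrite /c ltr_wpDl // addr_ge0 ?mulrn_wge0 // sumr_ge0.
exists c; split=> // T.
pose V (i : {ffun 'I_r -> 'I_T} * {ffun 'I_d -> 'I_T}) :=
  (\prod_l (a (inl l) ^+ i.1 l * b ^+ (T - i.1 l))) *
  (\prod_l (a (inr l) ^+ i.2 l * b ^+ (T - i.2 l))).
exists V => u u0.
have abE s (z : 'I_s -> K) (a' : 'I_s -> A) (mu : {ffun 'I_s -> 'I_T}) :
    (forall l, iota (a' l) = z l * iota b) ->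
    iota (\prod_l (a' l ^+ mu l * b ^+ (T - mu l))) = iota b ^+ (T * s) * mon z mu.
  move=> a'E; rewrite rmorph_prod /mon.
  rewrite exprM -[X in _ ^+ X]card_ord -prodr_const -big_split /=.
  apply: eq_bigr => l _; rewrite rmorphM !rmorphXn /= a'E exprMn -mulrA -exprD.
  by rewrite subnKC; [exact: mulrC | exact: ltnW].
have VE i : iota (V i) = iota b ^+ (T * (r + d)) * (mon x i.1 * mon y i.2).
  rewrite rmorphM (abE _ x) => [|l]; last exact: (aE (inl l)).
  rewrite (abE _ y) => [|l]; last exact: (aE (inr l)).
  by rewrite mulnDr exprD; ring.
have -> : iota (\sum_i h (u i) * V i) = iota b ^+ (T * (r + d)) *
    \sum_i (iota \o h) (u i) * (mon x i.1 * mon y i.2).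
  by rewrite rmorph_sum mulr_sumr; apply: eq_bigr => i _; rewrite /= rmorphM VE; ring.
move=> /vgt_mul; rewrite expf_neq0 // => /(_ isT).
have low := monomials_not_vgt x0 x_indep y_indep u0.
move=> H; apply: low; apply: vgt_le H; rewrite val_exp // /c mulnC mulrnA -mulrnBl.
by apply: ler_wMn2r; rewrite addrAC addrK lerDl.
Qed.

Theorem value_le_order : exists C : R, 0 < C /\
  forall n (U : {mpoly A[D]}), U \is n.-homog -> (exists b, ~ m U@_b) ->
    iota U.@[g] != 0 -> v (iota U.@[g]) <= C *+ n.
Proof.
have [c [c0 cP]] := low_value_family.
have [c1 c10 c1P] := gen_value_bound v_centered g_m.
have [L0 L0P] : exists L0 : nat, c < c1 *+ L0.
  exists (Num.bound (c / c1)); rewrite -mulr_natl -ltr_pdivrMr //.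
  by apply: archi_boundP; rewrite divr_ge0 ?ltW.
pose B := (#|F| * L0 ^ D.-1).+1.
exists (c *+ B); split; first by rewrite mulrn_wgt0.
move=> n U Uh U1 U0.
have [b mb] := U1.
have degb : mdeg b = n.
  apply: (dhomog_mf Uh); rewrite mcoeff_msupp; apply: contra_notN mb => /eqP ->.
  by case: m_ideal.
have [n0|n0] := posnP n.
  rewrite n0 in Uh degb *.
  have UC : U = (U@_0)%:MP.
    apply/mpolyP => c'; rewrite mcoeffC.
    have [->|c'0] := eqVneq c' 0%MM; first by rewrite mulr1.
    by rewrite mulr0; apply: dhomog_nemf_coeff Uh _; rewrite mdeg_eq0.
  move/eqP: degb; rewrite mdeg_eq0 => /eqP b00; rewrite b00 in mb.
  by rewrite UC mevalC (val_center_unit v_centered mb).2 mulr0n.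
pose T := (#|F| * n * L0 ^ D.-1).+1.
apply: (@le_trans _ _ (c *+ T)); last first.
  by rewrite -mulrnA; apply: ler_wpMn2l; [exact: ltW | rewrite /T /B; nia].
rewrite leNgt; apply/negP => vU.
pose I0 : set A := [set a | vgt v (c *+ T) (iota a)].
have I0_ideal : is_ideal I0 by apply: vgt_center_ideal.
have g_I0 c' : (L0 * T <= mdeg c')%N -> I0 (mmap1 g c').
  move=> Lb; have [b0|bv] := vge_monomial c' c1P; [by left|right].
  apply: lt_le_trans bv; apply: (@lt_le_trans _ _ (c1 *+ (L0 * T))).
    by rewrite mulrnA ltrMn2r L0P.
  by apply: ler_wpMn2l => //; apply: ltW.
have U_I0 : I0 U.@[g] by right.
have [J [s [sJ cardJ]]] := monomial_span m_ideal m_unit m_gen e_span I0_ideal Uh U1 U_I0 g_I0.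
have [V VP] := cP T.
have JT : (#|J| < #|{: {ffun 'I_r -> 'I_T} * {ffun 'I_d -> 'I_T}}|)%N.
  rewrite card_prod !card_ffun !card_ord -expnD.
  apply: leq_ltn_trans cardJ _; apply: (@leq_trans (T ^ D)); last by rewrite leq_pexp2l.
  have D0 : (0 < D)%N.
    rewrite lt0n; apply/eqP => D0; move: n0; rewrite -degb mdegE big1 // => i _.
    by have := ltn_ord i; rewrite [X in (_ < X)%N]D0.
  have -> : (T ^ D = T * T ^ D.-1)%N by rewrite -expnS prednK.
  rewrite expnMn !mulnA.
  by rewrite ltn_pmul2r ?expn_gt0.
have [u [u0 uV]] := span_dependent I0_ideal sJ V JT.
exact: VP u0 uV.
Qed.

End OrderUpperBound.

(** * Centers of Abhyankar valuations *)

Lemma local_unit (A : comNzRingType) (m : set A) a :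
  is_local m -> ~ m a -> exists u, a * u = 1.
Proof.
move=> [_ m_uniq] ma; apply: contrapT => /forallNP nu.
pose proper (X : set A) := [/\ is_ideal X, X a & ~ X 1].
have aP : proper [set x | exists u, x = a * u].
  split=> [|/=|/= [u /esym /nu]//]; last by exists 1; rewrite mulr1.
  split=> [|_ _ [u ->] [t ->]|b _ [u ->]] /=; first by exists 0; rewrite mulr0.
    by exists (u + t); rewrite mulrDr.
  by exists (b * u); rewrite mulrCA.
have [F FP Ftot|M [MP Mmax]] := @Zorn_bigcup A [set X | X = set0 \/ proper X].
  have [[X FX Xa]|F0] := pselect (exists2 X, F X & X a); last first.
    left; rewrite -subset0 => x [X FX Xx]; have [X0|[_ Xa _]] := FP X FX.
      by rewrite X0 in Xx.
    by case: F0; exists X.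
  have prop Y y : F Y -> Y y -> proper Y.
    by move=> /FP[->|].
  right; split; last 2 first.
  - by exists X.
  - by move=> [Y FY Y1]; have [_ _ /(_ Y1)] := prop _ _ FY Y1.
  split=> [|x y [Y FY Yx] [Z FZ Zy]|b x [Y FY Yx]].
  - by exists X => //; have [[]] := prop _ _ FX Xa.
  - have [YZ|ZY] := Ftot _ _ FY FZ.
      have [[_ ZD _] _ _] := prop _ _ FZ Zy.
      by exists Z => //; apply: ZD => //; apply: YZ.
    have [[_ YD _] _ _] := prop _ _ FY Yx.
    by exists Y => //; apply: YD => //; apply: ZY.
  - by exists Y => //; have [[_ _ YM] _ _] := prop _ _ FY Yx; apply: YM.
have {MP}[M0|[Mid Ma M1]] := MP.
  case: (Mmax [set x | exists u, x = a * u]); last by right.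
  by rewrite M0; split=> [//|/(_ a)]; apply; exists 1; rewrite mulr1.
apply: ma; rewrite -(m_uniq M) //; split=> // I Iid MI.
have [I1|I1] := pselect (I 1).
  right; rewrite -subTset => x _; have [_ _ IM] := Iid.
  by rewrite -[x]mulr1; apply: IM.
left; apply: contrapT => IM.
apply: (Mmax I); last by right; split=> //; apply: MI.
by split=> // IsubM; apply: IM; apply/seteqP.
Qed.

Section CenterResidue.
Variables (k K : fieldType) (A : comNzRingType) (R : realType).
Variables (j : {rmorphism k -> A}) (iota : {rmorphism A -> K}).
Variables (v : valuation (iota \o j) R) (va : forall a, iota a \in val_ge0 v).

Definition center_residue (a : A) : residue_field v := residue (ValuationRing (va a)).

Lemma center_residue_zmod_morphism : zmod_morphism center_residue.
Proof.
move=> a b; rewrite /center_residue -rmorphB; congr residue; apply: val_inj.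
by rewrite (raddfB (val : valuation_ring v -> K)) /= rmorphB.
Qed.

Lemma center_residue_monoid_morphism : monoid_morphism center_residue.
Proof.
split=> [|a b]; rewrite /center_residue.
  rewrite -(rmorph1 (@residue _ _ _ _ v)); congr residue; apply: val_inj.
  by rewrite (rmorph1 (val : valuation_ring v -> K)) /= rmorph1.
rewrite -rmorphM; congr residue; apply: val_inj.
by rewrite (rmorphM (val : valuation_ring v -> K)) /= rmorphM.
Qed.

HB.instance Definition _ :=
  GRing.isZmodMorphism.Build A (residue_field v) center_residue
    center_residue_zmod_morphism.
HB.instance Definition _ :=
  GRing.isMonoidMorphism.Build A (residue_field v) center_residue
    center_residue_monoid_morphism.

Lemma center_residue_base c : center_residue (j c) = residue_base v c.
Proof. by congr residue; apply: val_inj. Qed.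

Lemma center_residue_eq0 m a : centered v iota m -> center_residue a = 0 <-> m a.
Proof.
move=> [_ ->] /=; rewrite /center_residue; split=> [/eqP|av]; last apply/eqP;
by rewrite residue_eq0.
Qed.

End CenterResidue.

Lemma residue_lift (k K : fieldType) (f : {rmorphism k -> K}) (R : realType)
    (v : valuation f R) (z : residue_field v) : exists x, residue x = z.
Proof. by exists (repr (z : {ideal_quot (@valuation_ideal _ _ _ _ v)})); apply: residue_repr. Qed.

Lemma residue_neq0 (k K : fieldType) (f : {rmorphism k -> K}) (R : realType)
    (v : valuation f R) (x : valuation_ring v) :
  residue x != 0 -> vr_val x != 0 /\ v (vr_val x) = 0.
Proof.
rewrite residue_eq0 valuation_idealE negb_or -leNgt => /andP[x0 xle]; split=> //.
apply/eqP; rewrite eq_le xle; have := vr_valP x.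
by rewrite /val_ge0 /in_mem /= (negbTE x0).
Qed.

Lemma rational_rank_basis (R : realType) (G : set R) r :
    dimQ (tensorQ G) r ->
  exists x : 'I_r -> R, (forall i, G (x i)) /\
    forall a b : 'I_r -> nat, \sum_i x i *+ a i = \sum_i x i *+ b i -> a =1 b.
Proof.
move=> [e [eG eind _]].
have /choice[qx qxP] : forall i, exists qx : rat * R, G qx.2 /\ e i = ratr qx.1 * qx.2.
  by move=> i; have [q [x Gx eE]] := eG i; exists (q, x).
have q0 i : (qx i).1 != 0.
  apply/eqP => qi; have [_ ei] := qxP i; rewrite qi rmorph0 mul0r in ei.
  have : (i == i)%:R = 0 :> rat; last by move/eqP; rewrite eqxx oner_eq0.
  apply: (eind (fun l => (l == i)%:R)).
  by rewrite (bigD1 i) //= ei mulr0 add0r big1 // => l /negbTE ->; rewrite rmorph0 mul0r.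
exists (fun i => (qx i).2); split; first by move=> i; have [] := qxP i.
move=> a b ab i.
have c0 := eind (fun i => ((a i)%:R - (b i)%:R) / (qx i).1).
have /eqP : ((a i)%:R - (b i)%:R) / (qx i).1 = 0 :> rat.
  apply: c0; transitivity (\sum_i ((qx i).2 *+ a i - (qx i).2 *+ b i)).
    apply: eq_bigr => l _; have [_ ->] := qxP l.
    by rewrite mulrA -rmorphM divfK // rmorphB /= !ratr_nat mulrBl !mulr_natl.
  by rewrite sumrB ab subrr.
by rewrite mulf_eq0 invr_eq0 (negbTE (q0 i)) orbF subr_eq0 eqr_nat => /eqP.
Qed.

Section AbhyankarCenter.
Variables (R : realType) (k : fieldType) (A : comNzRingType) (K : fieldType).
Variables (j : {rmorphism k -> A}) (iota : {rmorphism A -> K}) (m : set A).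
Variable v : valuation (iota \o j) R.
Hypothesis A_local : is_local m.
Hypothesis A_eft : ess_finite_type j.
Hypothesis K_frac : is_fraction_field iota.
Hypothesis v_abhyankar : abhyankar v.
Hypothesis v_centered : centered v iota m.

Theorem abhyankar_le_order D (g : 'I_D -> A) :
    has_prime_chain A D -> m = ideal_gen g ->
  exists C : R, 0 < C /\
    forall n (U : {mpoly A[D]}), U \is n.-homog -> (exists b, ~ m U@_b) ->
      iota U.@[g] != 0 -> v (iota U.@[g]) <= C *+ n.
Proof.
move=> [Q [Qprime Qlt]] mE.
have m_ideal : is_ideal m by case: A_local => -[].
have m_unit a : ~ m a -> exists u, a * u = 1 by apply: local_unit.
have g_m i : m (g i).
  rewrite mE; exists (fun l => (l == i)%:R).
  by rewrite (bigD1 i) //= eqxx mul1r big1 ?addr0 // => l /negbTE ->; rewrite mul0r.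
have m_gen a : m a -> exists b : 'I_D -> A, a = \sum_i b i * g i by rewrite mE.
have [r [d [Gdim [T /alg_independentE Tfree _] Kdeg]]] : exists r d : nat,
   [/\ dimQ (tensorQ (value_group v)) r,
       exists2 T : 'I_d -> residue_field v, alg_independent (residue_base v) T & True
     & trdeg (iota \o j) (r + d)].
  by have [r [d [? [T [? _]] ?]]] := v_abhyankar; exists r, d; split=> //; exists T.
have iota_inj : injective iota by case: K_frac.
have va := v_centered.1.
have m1 : ~ m 1 by case: A_local => -[].
have free_le s (x : 'I_s -> A) (X : set A) : X 0 -> free_mod j X x -> (s <= r + d)%N.
  move=> X0 xfree; apply: (trdeg_free_le Kdeg (y := iota \o x)).
  apply/free_mod_comp; apply: free_mod_sub xfree => a /= a0.
  by rewrite (_ : a = 0) //; apply: iota_inj; rewrite a0 rmorph0.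
have m0 : m 0 by case: m_ideal.
have mj c : m (j c) -> c = 0.
  move=> mc; apply/eqP; apply: contrapT => /negP c0; apply: m1.
  have [_ _ mM] := m_ideal.
  by rewrite -(rmorph1 j) -(mulVf c0) rmorphM; apply: mM.
pose free_size t := `[< exists x : 'I_t -> A, free_mod j m x >].
have free0 : exists t, free_size t.
  by exists 0%N; apply/asboolP; exists (fun=> 0); apply: free_mod_nil.
have free_bound t : free_size t -> (t <= r + d)%N.
  by move=> /asboolP[x xfree]; apply: free_le xfree.
have [t /asboolP[tx txfree] tmax] := ex_maxnP free0 free_bound.
have Dt : (D + t <= r + d)%N.
  have QDm : Q D `<=` m.
    move=> a Qa; apply: contrapT => /m_unit[u au].
    have [[_ _ QM] Q1 _] := Qprime D (leqnn D); apply: Q1.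
    by rewrite -au mulrC; apply: QM.
  have [x xfree] := free_mod_prime_chain Qprime Qlt (free_mod_sub QDm txfree).
  by apply: free_le xfree; have [[]] := Qprime 0%N (leq0n D).
pose P := {mpoly k[t]}; pose h : {rmorphism P -> A} := mmap j tx.
pose rho : {rmorphism A -> residue_field v} := center_residue va.
have rho0 a : rho a = 0 <-> m a by apply: center_residue_eq0.
have rho_h q : rho (h q) = 0 -> q = 0.
  by move=> /rho0 mq; apply: (free_mod_mmap txfree).
have j_h c : exists q, h q = j c by exists c%:MP; apply: mmapC.
have rho_alg a : exists F : {poly residue_field v},
    [/\ F != 0, forall i, exists q, F`_i = rho (h q) & root F (rho a)].
  have : ~ free_mod j m (xcons a tx).
    move=> afree; suff : (t.+1 <= t)%N by rewrite ltnn.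
    by apply: tmax; apply/asboolP; exists (xcons a tx).
  move=> /not_free_mod_cons[B [c [[i0 [e0 c0]] mc]]].
  pose p i := boxpoly (c i).
  pose F := \poly_(i < B) (if insub i is Some i' then rho (h (p i')) else 0).
  have FE (i : 'I_B) : F`_i = rho (h (p i)) by rewrite coef_poly ltn_ord valK.
  exists F; split.
  - apply: contra_neq c0 => F0; rewrite -(mcoeff_boxpoly (c i0)).
    by rewrite -/(p i0) (rho_h (p i0)) ?mcoeff0 // -FE F0 coef0.
  - move=> i; rewrite coef_poly; case: ifP => _; last by exists 0; rewrite !rmorph0.
    by case: insub => [i'|]; [exists (p i') | exists 0; rewrite !rmorph0].
  - have := (rho0 _).2 mc; rewrite rmorph_sum => rmc.
    apply/rootP; rewrite horner_poly -[RHS]rmc; apply: eq_bigr => i _.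
    rewrite valK /= rmorphM rmorphXn; congr (_ * _).
    by rewrite /h /= mmap_boxpoly.
have [F [e eP]] := residue_span A_eft j_h rho_alg.
have e_span a : span_mod h m e a.
  have [q [c [q0 qa]]] := eP a; exists q, c; split=> //.
  by apply/rho0; rewrite rmorphB qa subrr.
have hx c : pol_val (residue_base v) (rho \o tx) ((rho \o h) c).
  exists (msize c), c => //=; rewrite /h /= /mmap rmorph_sum; apply: eq_bigr => b _.
  rewrite rmorphM /= -(center_residue_base va); congr (_ * _).
  by rewrite /mmap1 rmorph_prod; apply: eq_bigr => i _; rewrite rmorphXn.
have [s [y [yfree ds]]] := free_extend_full hx rho_h Tfree.
have /choice[Y YP] : forall i, exists x, residue x = y i by move=> i; apply: residue_lift.
have [xv [xvG xind]] := rational_rank_basis Gdim.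
have /choice[x xP] : forall i, exists z, z != 0 /\ v z = xv i.
  by move=> i; have [z z0 zE] := xvG i; exists z.
apply: (value_le_order v_centered K_frac m_ideal m_unit g_m m_gen e_span
  (x := x) (y := fun i => vr_val (Y i))).
- by move=> i; have [] := xP i.
- move=> a b ab; apply: xind.
  by under eq_bigr => i _ do rewrite -(xP i).2; under [RHS]eq_bigr => i _ do rewrite -(xP i).2.
- move=> B c [e0 c0].
  pose S := \sum_e (ValuationRing (va (h (c e)))) * mon Y e.
  have SE : vr_val S = \sum_e (iota \o h) (c e) * mon (fun i => vr_val (Y i)) e.
    rewrite /S (big_morph _ (@vr_valD _ _ _ _ v) (vr_val0 v)); apply: eq_bigr => b _.
    rewrite vr_valM /mon (big_morph _ (@vr_valM _ _ _ _ v) (vr_val1 v)).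
    congr (_ * _); apply: eq_bigr => i _; elim: (nat_of_ord (b i)) => [|n IH].
      by rewrite !expr0 vr_val1.
    by rewrite !exprS vr_valM IH.
  rewrite -SE; apply: residue_neq0; apply: contra_neq c0 => S0; apply: (yfree B c).
  apply: etrans S0; rewrite /S rmorph_sum; apply: eq_bigr => b _ /=.
  rewrite rmorphM rmorph_prod; congr (_ * _); apply: eq_bigr => i _.
  by rewrite rmorphXn /= YP.
- by rewrite -(leq_add2r t) (leq_trans Dt) // -addnA leq_add2l addnC.
Qed.

End AbhyankarCenter.

Theorem corollaryC (R : realType) (p : nat) (k : fieldType)
    (A : comNzRingType) (K : fieldType) (j : {rmorphism k -> A})
    (iota : {rmorphism A -> K}) (m : set A) (v w : valuation (iota \o j) R)
    (k_perfect : perfect_char p k)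
    (A_regular : regular_local m)
    (A_eft : ess_finite_type j)
    (K_frac : is_fraction_field iota)
    (v_nontrivial : nontrivial v) (w_nontrivial : nontrivial w)
    (v_abhyankar : abhyankar v) (w_abhyankar : abhyankar w)
    (v_centered : centered v iota m) (w_centered : centered w iota m) :
  exists C : R, 0 < C /\
    forall x : A, x != 0 -> v (iota x) <= C * w (iota x).
Proof.
case: A_regular => _ A_local [D [g [[Dchain _] mE]]].
have [C [C0 CP]] := abhyankar_le_order A_local A_eft K_frac v_abhyankar v_centered Dchain mE.
have g_m i : m (g i).
  rewrite mE; exists (fun l => (l == i)%:R).
  by rewrite (bigD1 i) //= eqxx mul1r big1 ?addr0 // => l /negbTE ->; rewrite mul0r.
have m_gen a : m a -> exists b : 'I_D -> A, a = \sum_i b i * g i by rewrite mE.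
have [cv cv0 cvP] := gen_value_bound v_centered g_m.
have [cw cw0 cwP] := gen_value_bound w_centered g_m.
exists (C / cw); split; first exact: divr_gt0.
move=> x x0; have ix0 : iota x != 0.
  by apply: contra_neq x0 => ix0; case: K_frac => inj _; apply: inj; rewrite ix0 rmorph0.
pose order_ge n := `[< exists2 U : {mpoly A[D]}, U \is n.-homog & x = U.@[g] >].
have order0 : exists n, order_ge n.
  exists 0%N; apply/asboolP; exists x%:MP; last by rewrite mevalC.
  by apply/dhomogP => b; rewrite msuppC; case: ifP => // _; rewrite inE => /eqP ->; apply: mdeg0.
have order_bound n : order_ge n -> (n <= Num.bound (v (iota x) / cv))%N.
  move=> /asboolP[U Uh xU]; apply: ltnW; rewrite -(ltr_nat R).
  have [/eqP|xn] := vge_homog v_centered cvP Uh; first by rewrite -xU (negbTE ix0).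
  rewrite -xU in xn; apply: (@le_lt_trans _ _ (v (iota x) / cv)).
    by rewrite ler_pdivlMr // mulr_natl.
  by apply: archi_boundP; rewrite divr_ge0 ?(ltW cv0) // (le_trans _ xn) // mulrn_wge0 // ltW.
have [n /asboolP[U Uh xU] nmax] := ex_maxnP order0 order_bound.
have U1 : exists b, ~ m U@_b.
  apply: (homog_coef_unit m_gen Uh) => V Vh UV; have := nmax n.+1.
  by rewrite ltnn => H; suff : false by []; apply: H; apply/asboolP; exists V; rewrite // xU.
apply: le_trans (_ : C *+ n <= _); first by rewrite xU; apply: CP => //; rewrite -xU.
have [/eqP|xn] := vge_homog w_centered cwP Uh; first by rewrite -xU (negbTE ix0).
rewrite -xU in xn; rewrite -mulrA -mulr_natr ler_pM2l // mulrC ler_pdivlMr //.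
by rewrite mulr_natl.
Qed.
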